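(* If $X$ is an $\mathcal{H}$-measurable a.s. non-empty random closed convex set in $\mathfrak{X}$, then $\mathbf{E}^g(X|\mathcal{H})=X$ a.s.
   Context: $\mathfrak{X}$ is a separable real Banach space with Borel $\sigma$-algebra $\mathcal{B}(\mathfrak{X})$; $(\Omega,\mathcal{F},\mathbf{P})$ is a complete probability space and $\mathcal{H}\subset\mathcal{F}$ is a sub-$\sigma$-algebra. An $\mathcal{H}$-measurable random set is a set-valued function $\omega\mapsto X(\omega)\subset\mathfrak{X}$ whose graph belongs to $\mathcal{H}\otimes\mathcal{B}(\mathfrak{X})$; it is closed (convex) if its values are closed (convex) for almost all $\omega$. For $\mathcal{G}\subset\mathcal{F}$, $\mathcal{L}^0(X,\mathcal{G})$ is the family of $\mathcal{G}$-measurable random elements $\xi$ with $\xi\in X$ a.s. $\operatorname{cl}_0$ is the closure in probability. A random element $\xi\in\mathcal{L}^0(\mathfrak{X},\mathcal{F})$ admits a generalised conditional expectation if there is a countable $\mathcal{H}$-measurable partition $\{A_i,i\geq1\}$ of $\Omega$ such that $\xi\mathbf{1}_{A_i}$ is integrable for all $i$; then $\mathbf{E}^g(\xi|\mathcal{H})=\sum_{i}\mathbf{E}(\xi\mathbf{1}_{A_i}|\mathcal{H})\mathbf{1}_{A_i}$. $\mathcal{L}^{1_{\mathcal{H}}}(X,\mathcal{F})$ is the family of $\xi\in\mathcal{L}^0(X,\mathcal{F})$ admitting a generalised conditional expectation. If this family is non-empty, $\mathbf{E}^g(X|\mathcal{H})$ is the (a.s. unique) $\mathcal{H}$-measurable random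 closed set such that $\mathcal{L}^0(\mathbf{E}^g(X|\mathcal{H}),\mathcal{H})=\operatorname{cl}_0\{\mathbf{E}^g(\xi|\mathcal{H}):\ \xi\in\mathcal{L}^{1_{\mathcal{H}}}(X,\mathcal{F})\}$. *)

(* Defs.v *)
From HB Require Import structures.
From mathcomp Require Import all_boot all_order all_algebra.
From mathcomp Require Import all_classical all_reals all_analysis.

Set Implicit Arguments.
Unset Strict Implicit.
Unset Printing Implicit Defensive.

Import Order.TTheory GRing.Theory Num.Theory.
Import numFieldNormedType.Exports.

Local Open Scope classical_set_scope.
Local Open Scope ring_scope.

Definition separable (V : topologicalType) :=
  exists D : set V, countable D /\ dense D.

(* The measurable sets of [g_sigma_algebraType G] are those of <<s G >>, which
   is G itself when G is a sigma-algebra; here they are the Borel sets of V. *)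
Notation borel V := (g_sigma_algebraType (@open V)).

Section random_sets.
Context {d : measure_display} {T : measurableType d} {R : realType}.
Context {V : completeNormedModType R}.
Variable P : probability T R.
Implicit Types (F G H : set (set T)) (X Y : T -> set V) (xi eta zeta : T -> V).

Definition sub_sigma_algebra_of H F := sigma_algebra setT H /\ H `<=` F.

Definition random_element G xi :=
  measurable_fun setT (xi : g_sigma_algebraType G -> borel V).

(* Measurability of the graph for the product sigma-algebra G (x) B(V). *)
Definition random_set G X :=
  measurable ([set p | X p.1 p.2] : set (g_sigma_algebraType G * borel V)).

Definition ae_closed X := {ae P, forall w, closed (X w)}.

Definition ae_convex X := {ae P, forall w, convex_set (X w)}.

Definition ae_nonempty X := {ae P, forall w, X w !=set0}.

Definition L0 X G : set (T -> V) :=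
  [set xi | random_element G xi /\ {ae P, forall w, X w (xi w)}].

Definition cvg_in_probability (xi : nat -> T -> V) eta :=
  forall e : R, 0 < e ->
    P [set w | e <= `|xi n w - eta w|] @[n --> \oo] --> 0%E.

(* Closure in probability inside L0(V, G).  Elements are functions rather than
   classes modulo a.s. equality, so the limit is taken to be G-measurable. *)
Definition cl0 G (S : set (T -> V)) : set (T -> V) :=
  [set eta | random_element G eta /\
     exists xi : nat -> T -> V,
       (forall n, S (xi n)) /\ cvg_in_probability xi eta].

Definition simple_element xi :=
  random_element measurable xi /\ finite_set (range xi).

(* Vector-valued analogue of [sintegral]. *)
Definition simple_integral xi : V :=
  \sum_(x \in range xi) fine (P (xi @^-1` [set x])) *: x.

Definition bochner_integrable xi :=
  random_element measurable xi /\ (\int[P]_w (`|xi w|)%:E < +oo)%E.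

(* v is the Bochner integral of xi over the whole space. *)
Definition is_bochner_integral xi (v : V) :=
  random_element measurable xi /\
  exists s : nat -> T -> V,
    [/\ forall n, simple_element (s n),
        (\int[P]_w (`|xi w - s n w|)%:E)%E @[n --> \oo] --> 0%E
      & simple_integral (s n) @[n --> \oo] --> v].

Definition restrict_elt (A : set T) xi : T -> V := fun w => \1_A w *: xi w.

(* eta is a version of E(xi | H). *)
Definition is_condexp H xi eta :=
  [/\ bochner_integrable xi, random_element H eta, bochner_integrable eta &
      forall A, H A -> exists v : V,
        is_bochner_integral (restrict_elt A xi) v /\
        is_bochner_integral (restrict_elt A eta) v].

(* Cells may be empty, so finite partitions are included. *)
Definition countable_partition H (A : nat -> set T) :=
  [/\ forall i, H (A i), trivIset setT A & \bigcup_i A i = setT].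

Definition admits_gcondexp H xi :=
  exists A : nat -> set T, countable_partition H A /\
    forall i, bochner_integrable (restrict_elt (A i) xi).

(* eta is a version of E^g(xi | H). *)
Definition is_gcondexp H xi eta :=
  exists (A : nat -> set T) (zeta : nat -> T -> V),
    [/\ countable_partition H A,
        forall i, bochner_integrable (restrict_elt (A i) xi),
        forall i, is_condexp H (restrict_elt (A i) xi) (zeta i)
      & forall w,
          \sum_(i < n) restrict_elt (A i) (zeta i) w @[n --> \oo] --> eta w].

Definition L1H H X : set (T -> V) :=
  [set xi | L0 X measurable xi /\ admits_gcondexp H xi].

(* Y is a version of the random closed set E^g(X | H), which is only defined
   when L1H H X is non-empty. *)
Definition is_gcondexp_set H X Y :=
  [/\ L1H H X !=set0, random_set H Y, ae_closed Y &
      L0 Y H = cl0 H [set eta | exists2 xi, L1H H X xi & is_gcondexp H xi eta]].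

End random_sets.

(* Main.v *)
Require Import Defs.
From HB Require Import structures.
From mathcomp Require Import all_boot all_order all_algebra.
From mathcomp Require Import all_classical all_reals all_analysis.
From mathcomp Require Import measurable_realfun lra ring.
Set Implicit Arguments.
Unset Strict Implicit.
Unset Printing Implicit Defensive.
Import Order.TTheory GRing.Theory Num.Theory.
Import numFieldNormedType.Exports.
Local Open Scope classical_set_scope.
Local Open Scope ring_scope.

(** An [H]-measurable selection of [X] is its own generalised conditional
    expectation (localise it to the sets where its norm lies between two
    consecutive integers), so one inclusion of the defining equality
    [L0 X H = cl0 H {E^g(xi | H)}] is immediate.  As [X] has closed values, the
    reverse inclusion amounts to: a conditional expectation [zeta] of a
    selection [xi] of [X] takes its values in [X] ([condexp_mem]).

    A countable family of functionals need not separate points from a randomly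
    varying unbounded convex set, so the argument compares averages instead of
    separating.  If [zeta] left [X] on a non-null set, then on some
    non-null [C] in [H] it would stay in a fixed ball [B(q, r)] while [X] misses
    [B(q, 2r)].  Approximate [xi] by points of a dense sequence [c].  Whether [X]
    meets a ball around [c i] is, up to a null set, an [H]-measurable event
    ([measurable_hitting]), so there is a non-null piece [C'] of [C] in [H] on
    which each of the finitely many events that matter is constant
    ([split_atoms]).  The average of [xi] over [C'] is close to a convex
    combination of those [c i] that [xi] approaches on [C'], and each of these is
    close to [X w] for every [w] in [C'], not only for the [w] at which [xi w] is
    near [c i]; hence the average is close to a point of the convex set [X w].
    But it is also the average of [zeta] over [C'], which lies in the closure of
    [B(q, r)] ([condexp_ball_hits]).

    Both this argument and the two remaining points, namely that [X] has an
    [H]-measurable selection and that [X] is determined up to null sets by its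
    [H]-measurable selections ([L0_sub_subset]), rest on a selection theorem for
    graphs in the product of [H] with the Borel sets ([measurable_selection]).
    Since [H] need not be complete, the selection is defined on a member of [H]
    that fills the projection of the graph up to a null set.  Its proof is
    Choquet's capacity argument.  A measurable graph is a Souslin set built from
    rectangles ([measurable_souslin]); its factors in [V] can be taken with
    diameters tending to zero, so that by Cantor's theorem a point of the
    section is the same thing as a branch of a tree of members of [H].
    Continuity from below of the outer measure bounds the coordinates of the
    branches at the cost of little measure; in the resulting finitely branching
    tree, Koenig's lemma makes the existence of a branch, and the choice of the
    leftmost one, measurable ([baire_selection]). *)

(** * Countable operations in a sigma-algebra *)

Section sigma_algebra_lemmas.
Context {T : Type} {H : set (set T)}.
Hypothesis sH : sigma_algebra setT H.

(** Members of [H] are handled as predicates: these lemmas mirror the logical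
    connectives, so that the measurability of a set follows the syntax of its
    definition. *)
Lemma sa_not (Q : T -> Prop) : H [set w | Q w] -> H [set w | ~ Q w].
Proof. by case: sH => _ hC _ /hC; rewrite setTD. Qed.

Lemma sa_ex (I : countType) (Q : I -> T -> Prop) :
  (forall i, H [set w | Q i w]) -> H [set w | exists i, Q i w].
Proof.
case: sH => h0 _ hU HQ.
have := hU (fun n => [set w | exists2 i, unpickle n = Some i & Q i w]).
rewrite (_ : \bigcup_k _ = [set w | exists i, Q i w]).
  apply => n; case: (unpickle n) => [i|].
    rewrite (_ : mkset _ = [set w | Q i w])//; apply/seteqP; split=> w /=.
      by move=> [_ [<-]].
    by exists i.
  by rewrite (_ : mkset _ = set0)//; apply/seteqP; split=> w //= [].
apply/seteqP; split => [w [n _ [i _ ?]]|w [i Qi]]; first by exists i.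
by exists (pickle i) => //; exists i => //; rewrite pickleK.
Qed.

Lemma sa_all (I : countType) (Q : I -> T -> Prop) :
  (forall i, H [set w | Q i w]) -> H [set w | forall i, Q i w].
Proof.
move=> HQ; have /sa_not : H [set w | exists i, ~ Q i w].
  by apply: sa_ex => i; exact: sa_not.
rewrite (_ : mkset _ = [set w | forall i, Q i w])//; apply/seteqP; split=> w /=.
  by move=> /forallNP h i; have /contrapT := h i.
by move=> h [i]; apply.
Qed.

Lemma sa_cst (Q : Prop) : H [set _ | Q].
Proof.
case: sH => h0 hC _; have [q|nq] := pselect Q.
  by have := hC _ h0; rewrite setD0 (_ : mkset _ = setT)//; apply/seteqP; split.
by rewrite (_ : mkset _ = set0)//; apply/seteqP; split.
Qed.

Lemma sa_or (Q1 Q2 : T -> Prop) :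
  H [set w | Q1 w] -> H [set w | Q2 w] -> H [set w | Q1 w \/ Q2 w].
Proof.
move=> h1 h2; have := @sa_ex bool (fun b => if b then Q1 else Q2).
rewrite (_ : mkset _ = [set w | Q1 w \/ Q2 w]); first by apply => -[].
apply/seteqP; split => w /=; first by move=> [[]]; [left|right].
by move=> [?|?]; [exists true|exists false].
Qed.

Lemma sa_and (Q1 Q2 : T -> Prop) :
  H [set w | Q1 w] -> H [set w | Q2 w] -> H [set w | Q1 w /\ Q2 w].
Proof.
move=> h1 h2; have := @sa_all bool (fun b => if b then Q1 else Q2).
rewrite (_ : mkset _ = [set w | Q1 w /\ Q2 w]); first by apply => -[].
apply/seteqP; split => w /=; first by move=> h; split; [exact: (h true)|exact: (h false)].
by move=> [? ?] [].
Qed.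

Lemma sa_setI (A B : set T) : H A -> H B -> H (A `&` B).
Proof. exact: (@sa_and A B). Qed.

Lemma sa_setD (A B : set T) : H A -> H B -> H (A `\` B).
Proof. by move=> hA /(@sa_not B); exact: (@sa_and A (fun w => ~ B w)). Qed.

Lemma sa_imp (Q1 Q2 : T -> Prop) :
  H [set w | Q1 w] -> H [set w | Q2 w] -> H [set w | Q1 w -> Q2 w].
Proof.
move=> h1 h2; have := sa_or (sa_not h1) h2.
rewrite (_ : mkset _ = [set w | Q1 w -> Q2 w])//; apply/seteqP; split => w /=.
  by move=> [].
by move=> h; have [/h|] := pselect (Q1 w); [right|left].
Qed.

(** A map into a countable type is measurable as soon as its fibres are. *)
Lemma sa_fibers (I : countType) (f : T -> I) (S : I -> Prop) :
  (forall i, H [set w | f w = i]) -> H [set w | S (f w)].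
Proof.
move=> Hf; rewrite (_ : mkset _ = [set w | exists i, f w = i /\ S i]).
  by apply: sa_ex => i; apply: sa_and => //; exact: sa_cst.
by apply/seteqP; split => w /= => [?|[i [<-]]//]; exists (f w).
Qed.

End sigma_algebra_lemmas.

(** The default value 0 is taken when nothing satisfies [Q]; it keeps [first]
    total, hence measurable on the whole space. *)
Definition first (Q : nat -> Prop) : nat :=
  if pselect (exists n, `[< Q n >]) is left h then ex_minn h else 0%N.

Lemma firstP (Q : nat -> Prop) : (exists n, Q n) ->
  Q (first Q) /\ forall i, Q i -> (first Q <= i)%N.
Proof.
move=> [n Qn]; rewrite /first; case: pselect => [h|[]]; last first.
  by exists n; apply/asboolP.
by case: ex_minnP => m /asboolP Qm mP; split=> // i Qi; apply/mP/asboolP.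
Qed.

Lemma sa_first {T} (H : set (set T)) (Q : T -> nat -> Prop) :
  sigma_algebra setT H -> (forall n, H [set w | Q w n]) ->
  forall n, H [set w | first (Q w) = n].
Proof.
move=> sH HQ n.
rewrite (_ : mkset _ = [set w | (Q w n /\ forall i, (i < n)%N -> ~ Q w i)
    \/ ((forall i, ~ Q w i) /\ n = 0%N)]).
  apply: (sa_or sH).
    apply: (sa_and sH) => //; apply: (sa_all sH) => i; apply: (sa_imp sH).
      exact: (sa_cst sH).
    exact: (sa_not sH).
  by apply: (sa_and sH); [apply: (sa_all sH) => i; exact: (sa_not sH)|exact: (sa_cst sH)].
apply/seteqP; split => w /=; last first.
  case=> [[Qn lt]|[nQ ->]].
    case: (@firstP (Q w)); first by exists n. move=> Qf le.
    apply/eqP; rewrite eqn_leq le//= leqNgt; apply/negP => /lt; exact.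
  by rewrite /first; case: pselect => // h; exfalso; case: h => i /asboolP /nQ.
have [ex|nex] := pselect (exists i, Q w i).
  case: (@firstP (Q w) ex) => Qf le; move=> <-; left; split=> // i lti /le.
  by rewrite leqNgt lti.
rewrite /first; case: pselect => [h|_ <-].
  by exfalso; apply: nex; case: h => i /asboolP; exists i.
by right; split=> // i Qi; apply: nex; exists i.
Qed.

Definition agree (N : nat) (s t : nat -> nat) := forall i, (i < N)%N -> s i = t i.

(** Continuity, for the discrete topology on [A], with a modulus that is
    uniform in the sequence. *)
Definition determined {A : Type} (Q : (nat -> nat) -> A) :=
  exists N, forall s t, agree N s t -> Q s = Q t.

(** A finite sequence stands for the basic open set of its extensions, and also
    for its own extension by zeros. *)
Definition seq_fun (l : seq nat) : nat -> nat := nth 0%N l.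

Lemma agree_mkseq N s : agree N (seq_fun (mkseq s N)) s.
Proof. by move=> i iN; rewrite /seq_fun nth_mkseq. Qed.

(** The union ranges over an uncountable set, but [Q s] only sees finitely many
    coordinates of [s], so finite sequences suffice. *)
Lemma sa_determined {T} (H : set (set T)) (S : set (nat -> nat))
    (Q : (nat -> nat) -> set T) :
  sigma_algebra setT H -> determined Q -> (forall s, H (Q s)) ->
  H [set w | exists s, S s /\ Q s w].
Proof.
move=> sH [N QN] HQ.
rewrite (_ : mkset _ = [set w | exists l : seq nat,
   (exists s, S s /\ agree N s (seq_fun l)) /\ Q (seq_fun l) w]).
  by apply: (sa_ex sH) => l; apply: (sa_and sH); [exact: (sa_cst sH)|exact: HQ].
apply/seteqP; split => w /=.
  move=> [s [Ss Qs]]; exists (mkseq s N); split.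
    by exists s; split => // i iN; rewrite (agree_mkseq s iN).
  by rewrite (QN _ _ (@agree_mkseq N s)).
by move=> [l [[s [Ss sl]] Ql]]; exists s; split => //; rewrite (QN _ _ sl).
Qed.

(** * Measurable selection along the branches of a tree *)

Section baire_selection.
Context {d : measure_display} {T : measurableType d} {R : realType}.
Variables (P : probability T R) (H : set (set T)).
Hypothesis (sH : sigma_algebra setT H) (HF : H `<=` measurable).

(** The outer measure of [A] computed in [H] is at least [c]; in this form it
    needs no infimum. *)
Definition outer_ge (c : R) (A : set T) :=
  forall B, H B -> A `<=` B -> (c%:E <= P B)%E.

(** Outer measures are continuous from below along arbitrary sets: the
    intersection of the hulls of [A n], [A n.+1], ... increases with [n], and
    measures are continuous from below. *)
Lemma outer_ge_continuity c c' (A : nat -> set T) (A0 : set T) :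
  (forall m n, (m <= n)%N -> A m `<=` A n) -> A0 `<=` \bigcup_n A n ->
  outer_ge c A0 -> c' < c -> exists n, outer_ge c' (A n).
Proof.
move=> Anondec A0A cA0 c'c; apply: contrapT => /forallNP nA.
have /choice[B BP] : forall n, exists B, [/\ H B, A n `<=` B & (P B < c'%:E)%E].
  move=> n; have /existsNP[B /not_implyP[HB /not_implyP[AB /negP]]] := nA n.
  by rewrite -ltNge => PB; exists B.
pose B' n := [set w | forall j, (n <= j)%N -> B j w].
have HB' n : H (B' n).
  apply: (sa_all sH) => j; apply: (sa_imp sH); first exact: (sa_cst sH).
  by have [] := BP j.
have HU : H (\bigcup_n B' n) by case: (sH) => _ _; apply.
have PU : (P \o B') @ \oo --> P (\bigcup_n B' n).
  apply: nondecreasing_cvg_mu; [by move=> n; exact/HF| exact/HF |].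
  move=> m n mn; apply/subsetPset => w h j nj; apply: h; exact: leq_trans nj.
have : (P (\bigcup_n B' n) <= c'%:E)%E.
  rewrite -(cvg_lim _ PU)//; apply: lime_le; first by apply/cvg_ex; eexists; exact: PU.
  apply: nearW => n /=; have [HB AB PB] := BP n; apply: le_trans (ltW PB).
  by apply: le_measure; rewrite ?inE; [exact/HF|exact/HF|move=> w; apply].
apply/negP; rewrite -ltNge; apply: (@lt_le_trans _ _ c%:E); first by rewrite lte_fin.
apply: cA0 => // w /A0A[n _ Anw]; exists n => // j nj.
by have [_ AB _] := BP j; apply: AB; exact: Anondec Anw.
Qed.

Variable B : nat -> (nat -> nat) -> set T.
Hypothesis HB : forall n s, H (B n s).
Hypothesis dB : forall n, determined (B n).
Hypothesis antiB : forall m n s, (m <= n)%N -> B n s `<=` B m s.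

Definition bounded_branch k (m : nat -> nat) :=
  [set w | exists s, (forall i, (i < k)%N -> (s i <= m i)%N) /\ forall n, B n s w].

(** The bounds are chosen one coordinate at a time. Letting the bound on
    coordinate [k] grow exhausts the branches already bounded below [k], so
    some finite bound loses an arbitrarily small part of the outer measure. *)
Lemma bounding_sequence c c' :
  outer_ge c [set w | exists s, forall n, B n s w] -> c' < c ->
  exists m, forall k, outer_ge c' (bounded_branch k m).
Proof.
move=> cB c'c.
pose upd (m : nat -> nat) k j i := if i == k then j else m i.
(* thresholds that decrease strictly from c to their limit c' *)
pose c_ k : R := c' + (c - c') / (2 ^+ k).
have c_lt k : c_ k.+1 < c_ k.
  rewrite /c_ ltrD2l exprS invfM mulrA ltr_pM2r ?invr_gt0 ?exprn_gt0//.
  rewrite ltr_pdivrMr// ltr_pMr ?subr_gt0//.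
  by rewrite (_ : 1 = 1%:R)// ltr_nat.
have c_ge k : c' < c_ k.
  by rewrite /c_ ltrDl mulr_gt0 ?subr_gt0// invr_gt0 exprn_gt0.
have step k m : exists j, outer_ge (c_ k) (bounded_branch k m) ->
    outer_ge (c_ k.+1) (bounded_branch k.+1 (upd m k j)).
  have [h|h] := pselect (outer_ge (c_ k) (bounded_branch k m)); last by exists 0%N.
  have [| |j hj] := outer_ge_continuity
      (A := fun j => bounded_branch k.+1 (upd m k j)) _ _ h (c_lt k).
  - move=> j j' jj' w [s [sm sB]]; exists s; split=> // i ik.
    by have := sm _ ik; rewrite /upd; case: eqP => // _ /leq_trans; apply.
  - move=> w [s [sm sB]]; exists (s k) => //; exists s; split=> // i; rewrite ltnS.
    by rewrite /upd leq_eqVlt; case: eqP => [->//|_ /= /sm].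
  by exists j.
have /choice[f fP] : forall km, exists j,
    outer_ge (c_ km.1) (bounded_branch km.1 km.2) ->
    outer_ge (c_ km.1.+1) (bounded_branch km.1.+1 (upd km.2 km.1 j)).
  by move=> [k m]; exact: step.
pose fix M k := if k is k'.+1 then upd (M k') k' (f (k', M k')) else (fun=> 0%N).
have MP k : outer_ge (c_ k) (bounded_branch k (M k)).
  elim: k => [|k IH]; last exact: (fP (k, M k)).
  move=> C HC sC; apply: (@le_trans _ _ c%:E).
    by rewrite lee_fin /c_ expr0 divr1 subrKC.
  by apply: cB => // w [s sB]; apply: sC; exists s.
have Mstable k i : (i < k)%N -> M k i = M i.+1 i.
  elim: k => // k IH; rewrite ltnS leq_eqVlt => /predU1P[->//|ik].
  by rewrite -IH//= /upd; case: eqP => // ?; subst; rewrite ltnn in ik.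
exists (fun i => M i.+1 i) => k C HC sC; apply: (@le_trans _ _ (c_ k)%:E).
  by rewrite lee_fin ltW.
apply: MP HC _ => w [s [sm sB]]; apply: sC; exists s; split=> // i ik.
by rewrite -(Mstable k)//; exact: sm.
Qed.

Variable m : nat -> nat.

(** The node [l] has descendants of every depth in the tree bounded by [m].
    Since the tree is finitely branching, this is the existence of an infinite
    branch through [l], and unlike the latter it is visibly a countable
    condition. *)
Definition extendable l w := forall n, exists s,
  ((forall i, (s i <= m i)%N) /\ agree (size l) s (seq_fun l)) /\ B n s w.

Lemma sa_extendable l : H (extendable l).
Proof.
apply: (sa_all sH) => n.
pose S s := (forall i, (s i <= m i)%N) /\ agree (size l) s (seq_fun l).
exact: (@sa_determined _ _ S _ sH (dB n) (HB n)).
Qed.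

(** The pigeonhole step of Koenig's lemma: only the [m (size l) + 1] children
    of [l] are allowed, so if each of them failed at some depth, the largest of
    these depths would fail for [l]. *)
Lemma extendable_rcons l w : extendable l w -> exists j, extendable (rcons l j) w.
Proof.
move=> lw; apply: contrapT => /forallNP nj.
have /choice[N NP] : forall j, exists n, ~ exists s,
    ((forall i, (s i <= m i)%N) /\ agree (size (rcons l j)) s (seq_fun (rcons l j)))
    /\ B n s w.
  by move=> j; have /existsNP := nj j.
have [s [[sm sl] Bs]] := lw (\max_(j < (m (size l)).+1) N j)%N.
apply: (NP (s (size l))); exists s; split; last first.
  apply: antiB Bs; have lt : (s (size l) < (m (size l)).+1)%N by rewrite ltnS.
  by rewrite (@leq_bigmax_cond _ predT (fun j : 'I_ _ => N j) (Ordinal lt)).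
split=> // i; rewrite size_rcons ltnS leq_eqVlt /seq_fun nth_rcons.
case/predU1P => [->|il]; first by rewrite ltnn eqxx.
by rewrite il; exact: sl.
Qed.

Fixpoint leftmost (w : T) k : seq nat :=
  if k is k'.+1 then
    rcons (leftmost w k') (first (fun j => extendable (rcons (leftmost w k') j) w))
  else [::].

Lemma size_leftmost w k : size (leftmost w k) = k.
Proof. by elim: k => //= k IH; rewrite size_rcons IH. Qed.

Lemma sa_leftmost k l : H [set w | leftmost w k = l].
Proof.
elim: k l => [|k IH] l; first exact: (sa_cst sH ([::] = l)).
rewrite (_ : mkset _ = [set w | exists p : seq nat * nat,
    leftmost w k = p.1 /\ first (fun j => extendable (rcons p.1 j) w) = p.2
    /\ rcons p.1 p.2 = l]).
  apply: (sa_ex sH) => -[l' j] /=; apply: (sa_and sH) => //.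
  apply: (sa_and sH); last exact: (sa_cst sH).
  by apply: (sa_first sH) => n; exact: sa_extendable.
apply/seteqP; split=> w /=; last by move=> [[l' j] /= [-> [-> ->]]].
by move=> <-; exists (leftmost w k,
  first (fun j => extendable (rcons (leftmost w k) j) w)).
Qed.

Lemma leftmost_extendable w k : extendable [::] w -> extendable (leftmost w k) w.
Proof.
move=> w0; elim: k => //= k IH.
have /firstP[] // := extendable_rcons IH.
Qed.

Definition leftmost_branch w i := nth 0%N (leftmost w i.+1) i.

Lemma mkseq_leftmost_branch w k : mkseq (leftmost_branch w) k = leftmost w k.
Proof.
have E i : (i < k)%N -> nth 0%N (leftmost w k) i = leftmost_branch w i.
  elim: k => // k IH; rewrite ltnS leq_eqVlt => /predU1P[->//|ik].
  by rewrite /= nth_rcons size_leftmost ik IH.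
apply: (@eq_from_nth _ 0%N); first by rewrite size_mkseq size_leftmost.
by move=> i; rewrite size_mkseq => ik; rewrite nth_mkseq// E.
Qed.

Lemma leftmost_branchP w n : extendable [::] w -> B n (leftmost_branch w) w.
Proof.
move=> w0; have [N NP] := dB n.
have [s [[_ sl] Bs]] := leftmost_extendable N w0 n.
rewrite -(NP s)// => i iN; rewrite sl ?size_leftmost//.
by rewrite -mkseq_leftmost_branch /seq_fun nth_mkseq.
Qed.

End baire_selection.

(** Once the coordinates are bounded by [m], the existence of a branch is the
    event [extendable B m [::]], on which the leftmost branch is a selection.
    It is a decreasing intersection of sets that contain the projection of the
    branches bounded up to some depth, so their measures are bounded below by
    its outer measure. *)
Lemma baire_selection d (T : measurableType d) (R : realType)
    (P : probability T R) (H : set (set T)) (B : nat -> (nat -> nat) -> set T) c c' :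
  sigma_algebra setT H -> H `<=` measurable ->
  (forall n s, H (B n s)) -> (forall n, determined (B n)) ->
  (forall m n s, (m <= n)%N -> B n s `<=` B m s) ->
  outer_ge P H c [set w | exists s, forall n, B n s w] -> c' < c ->
  exists C (s : T -> nat -> nat), [/\ H C, (c'%:E <= P C)%E,
    forall N l, H [set w | mkseq (s w) N = l] &
    forall w, C w -> forall n, B n (s w) w].
Proof.
move=> sH HF HB dB antiB cB c'c.
have [m mP] := bounding_sequence sH HF cB c'c.
exists (extendable B m [::]), (leftmost_branch B m); split.
- exact: sa_extendable.
- pose K n := [set w | exists s, (forall i, (s i <= m i)%N) /\ B n s w].
  have HK n : H (K n).
    exact: (@sa_determined _ _ (fun s => forall i, (s i <= m i)%N) _ sH (dB n) (HB n)).
  have -> : extendable B m [::] = \bigcap_n K n.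
    apply/seteqP; split => w h n; first by case: (h n) => s [[sm _] Bs]; exists s.
    by case: (h n I) => s [sm Bs]; exists s.
  have PK : (P \o K) @ \oo --> P (\bigcap_n K n).
    apply: nonincreasing_cvg_mu => //.
    + by apply: le_lt_trans (probability_le1 P _) _; [exact/HF|rewrite ltry].
    + by move=> n; exact/HF.
    + by apply: bigcapT_measurable => n; exact/HF.
    + move=> n n' nn'; apply/subsetPset => w [s [sm Bs]]; exists s; split=> //.
      exact: antiB Bs.
  rewrite -(cvg_lim _ PK)//; apply: lime_ge; first by apply/cvg_ex; eexists; exact: PK.
  apply: nearW => n /=; have [N NP] := dB n.
  apply: (mP N) => // w [s [sm sB]].
  (* B n only reads coordinates that are bounded already, so truncating the
     others is harmless *)
  exists (fun i => minn (s i) (m i)); split; first by move=> i; exact: geq_minr.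
  rewrite -(NP s)// => i /sm sm'; exact/esym/minn_idPl.
- by move=> N l; under eq_set do rewrite mkseq_leftmost_branch; exact: sa_leftmost.
- by move=> w wC n; exact: leftmost_branchP.
Qed.

(** * Measurable graphs as Souslin sets *)

Section random_elements.
Context {R : realType} {V : completeNormedModType R} {d : measure_display}
  {T : measurableType d}.
Implicit Types (H : set (set T)) (xi : T -> V).

Lemma random_elementP H xi : sigma_algebra setT H ->
  random_element H xi <-> forall U, open U -> H (xi @^-1` U).
Proof.
move=> sH; have Hid := sigma_algebra_id sH; split=> [mxi U oU|mxi].
  have := mxi measurableT U (@sub_sigma_algebra _ setT _ _ oU).
  by rewrite setTI /measurable/= Hid.
apply: (@measurability _ _ (g_sigma_algebraType H) (borel V) setT xi (@open V)) => //.
move=> _ [U oU <-].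
by rewrite setTI /measurable/= Hid; exact: mxi.
Qed.

(** Gluing along a countable measurable partition, given as the fibres of
    [label]. *)
Lemma random_element_glue H (I : countType) (label : T -> I) (xi : I -> T -> V) :
  sigma_algebra setT H -> (forall i, H [set w | label w = i]) ->
  (forall i, random_element H (xi i)) ->
  random_element H (fun w => xi (label w) w).
Proof.
move=> sH Hl Hxi; apply/random_elementP => // U oU.
rewrite (_ : _ @^-1` U = [set w | exists i, label w = i /\ U (xi i w)]).
  apply: (sa_ex sH) => i; apply: (sa_and sH) => //.
  by move/random_elementP: (Hxi i); apply.
by apply/seteqP; split => w /= => [?|[i [<-]]//]; exists (label w).
Qed.

Lemma random_element_if H (A : set T) xi eta : sigma_algebra setT H -> H A ->
  random_element H xi -> random_element H eta ->
  random_element H (fun w => (if w \in A then xi else eta) w).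
Proof.
move=> sH HA mxi meta.
apply: (random_element_glue (label := fun w => w \in A)
  (xi := fun b : bool => if b then xi else eta) sH); last by case.
case.
  by rewrite (_ : mkset _ = A)//; apply/seteqP; split => w /=; [move/set_mem|move/mem_set].
rewrite (_ : mkset _ = [set w | ~ A w]); first exact: (sa_not sH).
apply/seteqP; split => w /=; first by move=> wA /mem_set; rewrite wA.
by move=> nA; rewrite memNset.
Qed.

Lemma random_element_cst H x : sigma_algebra setT H -> random_element H (cst x : T -> V).
Proof. by move=> sH; apply/random_elementP => // U _; exact: (sa_cst sH (U x)). Qed.

Lemma random_elementS H F xi : sigma_algebra setT H -> sigma_algebra setT F ->
  H `<=` F -> random_element H xi -> random_element F xi.
Proof.
move=> sH sF HF /random_elementP hxi; apply/random_elementP => // U oU.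
exact/HF/hxi.
Qed.

End random_elements.

Section dense_sequence.
Context {R : realType} {V : completeNormedModType R}.

Definition dense_seq (q : nat -> V) := forall v e, 0 < e -> exists i, `|v - q i| < e.

Lemma separable_dense_seq : separable V -> exists q, dense_seq q.
Proof.
move=> [D [/countable_injP[f finj] dD]].
exists (fun n => xget 0 [set x | D x /\ f x = n]) => v e e0.
have [|v' [/= bv' Dv']] := dD (ball v e) _ (ball_open v e).
  by exists v; exact: ballxx.
exists (f v'); case: xgetP => [y _ [Dy fy]|/(_ v') []//].
by rewrite (finj _ _ _ _ fy) ?inE//; move: bv'; rewrite -ball_normE.
Qed.

Lemma dist_continuous (u : V) : continuous (fun v : V => `|v - u|).
Proof. by move=> v; apply: cvg_norm; apply: cvgB => //; exact: cvg_cst. Qed.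

(** Points at distance at least [1/(n+1)] from the complement form a closed
    set. *)
Lemma open_bigcup_closed (U : set V) : open U ->
  exists F : nat -> set V, (forall n, closed (F n)) /\ U = \bigcup_n F n.
Proof.
move=> oU.
pose F n := [set v : V | forall u, ~ U u -> n.+1%:R^-1 <= `|v - u|].
exists F; split.
  move=> n; rewrite (_ : F n = \bigcap_(u in ~` U) [set v | n.+1%:R^-1 <= `|v - u|]).
    apply: closed_bigI => u _.
    exact: ((continuous_closedP _).1 (@dist_continuous u) _ (@closed_ge _ _)).
  by apply/seteqP; split => v h u nU; exact: h.
apply/seteqP; split => v; last first.
  move=> [n _ Fv]; apply: contrapT => /Fv; rewrite subrr normr0.
  by apply/negP; rewrite -ltNge invr_gt0.
move=> Uv; have /nbhs_ballP[e /= e0 eU] : nbhs v U by exact: open_nbhs_nbhs.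
have [n] := ltr_add_invr e0; rewrite add0r => nP.
exists n => // u nUu; rewrite leNgt; apply/negP => lt; apply: nUu; apply: eU.
by rewrite -ball_normE /=; apply: lt_trans nP.
Qed.

End dense_sequence.

Section souslin.
Context {R : realType} {V : completeNormedModType R} {T : pointedType}.
Variable H : set (set T).
Hypothesis sH : sigma_algebra setT H.
Implicit Type G : set (T * V).

(** The Souslin operation applied to rectangles. Recording separately the
    dependence of both factors on finitely many coordinates of [s] makes the
    closure properties a matter of recoding sequences. *)
Definition souslin_scheme (D : nat -> (nat -> nat) -> set T)
    (F : nat -> (nat -> nat) -> set V) G :=
  [/\ (forall n s, H (D n s)) /\ (forall n s, closed (F n s)),
      forall n, determined (D n), forall n, determined (F n) &
      forall p, G p <-> exists s, forall n, D n s p.1 /\ F n s p.2].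

Definition souslin G := exists D F, souslin_scheme D F G.

Lemma souslin_rect (A : set T) (F : set V) : H A -> closed F ->
  souslin [set p | A p.1 /\ F p.2].
Proof.
move=> HA cF; exists (fun _ _ => A), (fun _ _ => F); split=> //.
- by move=> _; exists 0%N.
- by move=> _; exists 0%N.
by move=> p; split => [?|[s /(_ 0%N)]//]; exists (fun=> 0%N).
Qed.

Let dec n : nat * nat := odflt (0%N, 0%N) (unpickle n).
Let decK p : dec (pickle p) = p. Proof. by rewrite /dec pickleK. Qed.

Let shift (s : nat -> nat) : nat -> nat := fun n => s n.+1.

(** The first coordinate of the new sequence names a set [G i], the others a
    branch of its scheme. The condition at [n] is vacuous unless [n] encodes
    that [i]: this keeps the number of coordinates read at [n] bounded
    independently of [s]. *)
Lemma souslin_bigcup (G : nat -> set (T * V)) :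
  (forall i, souslin (G i)) -> souslin (\bigcup_i G i).
Proof.
move=> /choice[D] /choice[F] GDF.
pose here (A : Type) (E : nat -> nat -> (nat -> nat) -> set A) n s :=
  if s 0%N == (dec n).1 then E (dec n).1 (dec n).2 (shift s) else setT.
have here_det A (E : nat -> nat -> (nat -> nat) -> set A) :
    (forall i n, determined (E i n)) -> forall n, determined (here A E n).
  move=> dE n; have [N NP] := dE (dec n).1 (dec n).2; exists N.+1 => s t st.
  rewrite /here -(st 0%N)//; case: eqP => // _; apply: NP => i iN.
  exact: (st i.+1).
exists (here T D), (here V F); split.
- split=> n s; rewrite /here; case: eqP => _.
  + by have [[]] := GDF (dec n).1.
  + exact: (sa_cst sH True).
  + by have [[]] := GDF (dec n).1.
  + exact: closedT.
- by apply: here_det => i n; have [] := GDF i.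
- by apply: here_det => i n; have [] := GDF i.
move=> p; split.
  move=> [i _ Gp]; have [_ _ _ /(_ p) [/(_ Gp)[s sP] _]] := GDF i.
  exists (fun n => if n is n'.+1 then s n' else i) => n; rewrite /here/=.
  by case: eqP => // <-; exact: sP.
move=> [s sP]; exists (s 0%N) => //.
have [_ _ _ /(_ p) [_]] := GDF (s 0%N); apply; exists (shift s) => n.
by have := sP (pickle (s 0%N, n)); rewrite /here decK eqxx.
Qed.

(** One sequence encodes a branch for every [G i], through a pairing of the
    indices. *)
Lemma souslin_bigcap (G : nat -> set (T * V)) :
  (forall i, souslin (G i)) -> souslin (\bigcap_i G i).
Proof.
move=> /choice[D] /choice[F] GDF.
pose row (s : nat -> nat) (i n : nat) := s (pickle (i, n)).
pose here (A : Type) (E : nat -> nat -> (nat -> nat) -> set A) n s :=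
  E (dec n).1 (dec n).2 (row s (dec n).1).
have here_det A (E : nat -> nat -> (nat -> nat) -> set A) :
    (forall i n, determined (E i n)) -> forall n, determined (here A E n).
  move=> dE n; have [N NP] := dE (dec n).1 (dec n).2.
  exists (\max_(k < N) (pickle ((dec n).1, k : nat)).+1)%N => s t st.
  apply: NP => k kN; apply: st.
  exact: (@leq_bigmax_cond _ predT (fun k : 'I_N => (pickle ((dec n).1, k : nat)).+1)
    (Ordinal kN)).
exists (here T D), (here V F); split.
- by split=> n s; rewrite /here; have [[]] := GDF (dec n).1.
- by apply: here_det => i n; have [] := GDF i.
- by apply: here_det => i n; have [] := GDF i.
move=> p; split.
  move=> Gp.
  have /choice[s sP] : forall i, exists s, forall n, D i n s p.1 /\ F i n s p.2.
    by move=> i; have [_ _ _ /(_ p) [h _]] := GDF i; apply/h/Gp.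
  exists (fun n => s (dec n).1 (dec n).2) => n.
  have E i : row (fun n => s (dec n).1 (dec n).2) i = s i.
    by apply/funext => k; rewrite /row decK.
  by rewrite /here E; exact: sP.
move=> [s sP] i _; have [_ _ _ /(_ p) [_]] := GDF i; apply; exists (row s i) => n.
by have := sP (pickle (i, n)); rewrite /here decK.
Qed.

Lemma souslin_setX (A : set T) : H A -> souslin [set p | A p.1].
Proof.
move=> HA; have := souslin_rect HA (@closedT V).
by rewrite (_ : mkset _ = [set p | A p.1])//; apply/seteqP; split => p //= [].
Qed.

Lemma souslin_borel (B : set V) : (measurable : set (set (borel V))) B ->
  souslin [set p | B p.2] /\ souslin [set p | ~ B p.2].
Proof.
have HT : H setT := sa_cst sH True.
have closed_souslin F : closed F -> souslin [set p | F p.2].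
  move=> cF; have := souslin_rect HT cF.
  by rewrite (_ : mkset _ = [set p | F p.2])//; apply/seteqP; split => p //= [].
move: B; apply: smallest_sub; last first.
  move=> U oU; split; last exact: (closed_souslin _ (open_closedC oU)).
  have [F [cF ->]] := open_bigcup_closed oU.
  by apply: (@souslin_bigcup (fun n => [set p | F n p.2])) => n; exact: closed_souslin.
split.
- split; first exact: (closed_souslin _ (@closed0 V)).
  by apply: (closed_souslin (~` set0)); rewrite setC0; exact: closedT.
- move=> A [sA sAc]; rewrite setTD; split => //.
  rewrite (_ : mkset _ = [set p | A p.2])//; apply/seteqP; split => p /=.
    exact: contrapT.
  by move=> ? ?.
- move=> A sA; split.
    by apply: (@souslin_bigcup (fun n => [set p | A n p.2])) => n; have [] := sA n.
  have := @souslin_bigcap (fun n => [set p | ~ A n p.2]).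
  rewrite (_ : \bigcap_i _ = [set p | ~ (\bigcup_k A k) p.2]).
    by apply => n; have [] := sA n.
  apply/seteqP; split => p /=; first by move=> h [n _ An]; exact: (h n).
  by move=> h n _ An; apply: h; exists n.
Qed.

(** Complements of Souslin sets need not be Souslin, but the Souslin sets with
    Souslin complement form a sigma-algebra, and it contains the generating
    rectangles. *)
Lemma measurable_souslin (G : set (T * V)) :
  (measurable : set (set (g_sigma_algebraType H * borel V))) G -> souslin G.
Proof.
suff : (measurable : set (set (g_sigma_algebraType H * borel V))) `<=`
    [set G | souslin G /\ souslin (~` G)] by move=> h /h[].
have HT : H setT := sa_cst sH True.
have H0 : H set0 := sa_cst sH False.
apply: smallest_sub; last first.
  move=> _ [[A HA <-]|[B mB <-]]; rewrite setTI.
    have {}HA : H A by rewrite -(sigma_algebra_id sH).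
    split; first exact: souslin_setX.
    by apply: (@souslin_setX (~` A)); exact: (sa_not sH HA).
  exact: souslin_borel.
split.
- split; last by rewrite setC0; exact: (souslin_setX HT).
  exact: (souslin_setX H0).
- by move=> A [sA sAc]; rewrite setTD; split=> //; rewrite setCK.
- move=> A sA; split; first by apply: souslin_bigcup => n; have [] := sA n.
  by rewrite setC_bigcup; apply: souslin_bigcap => n; have [] := sA n.
Qed.

Definition shrinking (F : nat -> (nat -> nat) -> set V) :=
  forall e, 0 < e -> exists n, forall s x y, F n s x -> F n s y -> `|x - y| < e.

(** The even coordinates of a sequence carry the given scheme. The odd ones
    encode better and better approximations of the point of [V] by the dense
    sequence, and so force the diameters to zero without changing the set. *)
Lemma souslin_shrinking (q : nat -> V) G : dense_seq q -> souslin G ->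
  exists D F, souslin_scheme D F G /\ shrinking F.
Proof.
move=> dq [D [F [[HD cF] dD dF GP]]].
pose even_ (s : nat -> nat) k := s k.*2.
have even_det A (E : nat -> (nat -> nat) -> set A) :
    (forall n, determined (E n)) -> forall n, determined (fun s => E n (even_ s)).
  move=> dE n; have [N NP] := dE n; exists N.*2 => s t st; apply: NP => i iN.
  by apply: st; rewrite ltn_double.
pose near_center n (s : nat -> nat) := [set v | `|v - q (s n.*2.+1)| <= n.+1%:R^-1].
exists (fun n s => D n (even_ s)),
  (fun n s => F n (even_ s) `&` near_center n s); split; [split|].
- split=> [n s|n s]; first exact: HD.
  apply: closedI; first exact: cF.
  exact: ((continuous_closedP _).1 (@dist_continuous _ _ _) _ (@closed_le _ _)).
- exact: even_det.
- move=> n; have [N NP] := even_det _ _ dF n; exists (maxn N n.*2.+2) => s t st.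
  have -> : F n (even_ s) = F n (even_ t).
    by apply: NP => i iN; apply: st; rewrite leq_max iN.
  by rewrite /near_center (st n.*2.+1)// leq_maxr.
- move=> p; rewrite GP; split; last first.
    by move=> [s sP]; exists (even_ s) => n; have [? []] := sP n.
  move=> [s sP].
  have /choice[c cP] : forall n : nat, exists i, `|p.2 - q i| < n.+1%:R^-1.
    by move=> n; apply: dq; rewrite invr_gt0.
  exists (fun k => if odd k then c k./2 else s k./2) => n.
  have -> : even_ (fun k => if odd k then c k./2 else s k./2) = s.
    by apply/funext => k; rewrite /even_ odd_double doubleK.
  have [? ?] := sP n; split=> //; split=> //.
  by rewrite /near_center /= odd_double/= uphalf_double ltW.
- move=> e e0; have [n] : exists n : nat, 0 + n.+1%:R^-1 < e / 2.
    by apply: ltr_add_invr; rewrite divr_gt0.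
  rewrite add0r => nP; exists n => s x y [_ xn] [_ yn].
  rewrite -(subrKA (q (s n.*2.+1))) (le_lt_trans (ler_normD _ _))//.
  rewrite [e]splitr ltrD// ?(le_lt_trans xn)// distrC.
  exact: le_lt_trans yn nP.
Qed.

Lemma cantor_intersection (F : nat -> (nat -> nat) -> set V) s :
  (forall n, closed (F n s)) -> shrinking F ->
  (forall n, exists v, forall j, (j <= n)%N -> F j s v) ->
  exists v, forall n, F n s v.
Proof.
move=> cF shF /choice[v vP].
have cv : cvg (v n @[n --> \oo]).
  apply: cauchy_cvg; apply: cauchy_exP => e e0.
  have [n nP] := shF _ e0; exists (v n); exists n => // m nm /=.
  by rewrite -ball_normE /=; apply: (nP s); exact: vP.
exists (lim (v n @[n --> \oo])) => n.
apply: (@closed_cvg _ _ \oo _ v (F n s) (cF n) _ _ cv).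
by exists n => // m nm; exact: vP.
Qed.

End souslin.

(** * The measurable selection theorem *)

Section selection.
Context {d : measure_display} {T : measurableType d} {R : realType}
  {V : completeNormedModType R}.
Variables (P : probability T R) (H : set (set T)).
Hypothesis (sH : sigma_algebra setT H) (HF : H `<=` measurable).
Hypothesis sepV : separable V.
Implicit Type G : set (T * V).

Definition projection G := [set w | exists v, G (w, v)].

(** With shrinking factors a branch determines the point of [V], so that
    selecting branches is enough. *)
Lemma selection_outer_ge G c c' :
  (measurable : set (set (g_sigma_algebraType H * borel V))) G ->
  outer_ge P H c (projection G) -> c' < c ->
  exists C (xi : T -> V), [/\ H C, (c'%:E <= P C)%E, random_element H xi &
    forall w, C w -> G (w, xi w)].
Proof.
move=> mG cG c'c; have [q dq] := separable_dense_seq sepV.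
have [D [F [[[HD cF] dD dF GP] shF]]] := souslin_shrinking dq (measurable_souslin sH mG).
(* w survives to depth n along s if the D-conditions hold and the F-conditions
   are consistent; the second clause does not depend on w *)
pose B n s := [set w | (forall j, (j <= n)%N -> D j s w) /\
  exists v, forall j, (j <= n)%N -> F j s v].
have BG w s : (forall n, B n s w) -> exists v, forall n, D n s w /\ F n s v.
  move=> Bs; have [//||v vP] := cantor_intersection (s := s) _ shF.
    by move=> n; have [] := Bs n.
  by exists v => n; split=> //; have [h _] := Bs n; exact: h.
have det_upto A (E : nat -> (nat -> nat) -> A) n : (forall n, determined (E n)) ->
    exists N, forall s t, agree N s t -> forall j, (j <= n)%N -> E j s = E j t.
  move=> dE; elim: n => [|n [N NP]].
    have [N NP] := dE 0%N; exists N => s t /NP e j; rewrite leqn0 => /eqP ->//.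
  have [M MP] := dE n.+1; exists (maxn N M) => s t st j.
  rewrite leq_eqVlt => /predU1P[->|jn].
    by apply: MP => i iM; apply: st; rewrite leq_max iM orbT.
  by apply: (NP) => // i iN; apply: st; rewrite leq_max iN.
have [| | | |C [s [HC PC ms sB]]] := @baire_selection _ _ _ P H B c c' sH HF _ _ _ _ c'c.
- move=> n s; apply: (sa_and sH); last exact: (sa_cst sH).
  apply: (sa_all sH) => j; apply: (sa_imp sH); first exact: (sa_cst sH).
  exact: HD.
- move=> n; have [N NP] := det_upto _ D n dD; have [M MP] := det_upto _ F n dF.
  exists (maxn N M) => s t st; rewrite /B.
  have sD j : (j <= n)%N -> D j s = D j t.
    by apply: NP => i iN; apply: st; rewrite leq_max iN.
  have sF j : (j <= n)%N -> F j s = F j t.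
    by apply: MP => i iM; apply: st; rewrite leq_max iM orbT.
  apply/seteqP; split=> w /= [h [v vP]]; split.
  + by move=> j jn; rewrite -sD//; exact: h.
  + by exists v => j jn; rewrite -sF//; exact: vP.
  + by move=> j jn; rewrite sD//; exact: h.
  + by exists v => j jn; rewrite sF//; exact: vP.
- move=> m n s mn w [h [v vP]]; split; first by move=> j jm; apply: h; exact: leq_trans mn.
  by exists v => j jm; apply: vP; exact: leq_trans mn.
- move=> A HA GA; apply: cG => // w [v /GP[s sP]]; apply: GA; exists s => n.
  by split; [move=> j _; have [] := sP j|exists v => j _; have [] := sP j].
have /choice[xi xiP] : forall w, exists v, C w ->
    forall n, D n (s w) w /\ F n (s w) v.
  move=> w; have [Cw|nCw] := pselect (C w); last by exists 0.
  by have [v vP] := BG w (s w) (sB w Cw); exists v.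
exists C, (fun w => if w \in C then xi w else 0); split => //; last first.
  move=> w Cw; rewrite mem_set//; apply/GP; exists (s w) => n; exact: xiP.
apply/random_elementP => // U oU.
(* the selected point lies in the open set U iff some F n along the branch is
   contained in U, a condition that reads finitely many coordinates *)
rewrite (_ : _ @^-1` U = [set w | (C w /\ exists n, F n (s w) `<=` U) \/
    (~ C w /\ U 0)]).
  apply: (sa_or sH); apply: (sa_and sH) => //; last exact: (sa_cst sH).
    apply: (sa_ex sH) => n; have [N NP] := dF n.
    rewrite (_ : mkset _ = [set w | F n (seq_fun (mkseq (s w) N)) `<=` U]).
      exact: (@sa_fibers _ _ sH _ (fun w => mkseq (s w) N)
        (fun l => F n (seq_fun l) `<=` U) (ms N)).
    by apply/seteqP; split=> w /=; rewrite (NP _ _ (agree_mkseq _)).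
  exact: (sa_not sH).
apply/seteqP; split=> w /=; last first.
  by move=> [[Cw [n FU]]|[nCw U0]]; [rewrite mem_set//; apply/FU/(xiP w Cw n).2|
    rewrite memNset].
have [Cw|nCw] := pselect (C w); last by rewrite memNset//; right.
rewrite mem_set// => Uxi; left; split=> //.
have /nbhs_ballP[e /= e0 eU] : nbhs (xi w) U by exact: open_nbhs_nbhs.
have [n nP] := shF _ e0; exists n => v Fv; apply: eU; rewrite -ball_normE /=.
apply: (nP (s w)) => //; exact: (xiP w Cw n).2.
Qed.

(** The measurable selection theorem of von Neumann and Aumann, for a
    sigma-algebra that need not be complete. Selections obtained for outer
    measures closer and closer to that of the projection are glued; the null
    set is controlled by measurable hulls. *)
Theorem measurable_selection G :
  (measurable : set (set (g_sigma_algebraType H * borel V))) G ->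
  exists D (xi : T -> V), [/\ H D, random_element H xi,
    forall w, D w -> G (w, xi w) & P.-negligible (projection G `\` D)].
Proof.
move=> mG; pose S := [set c | outer_ge P H c (projection G)].
have HT : H setT := sa_cst sH True.
have supS : has_sup S.
  split; first by exists 0 => B HB _; exact: measure_ge0.
  exists 1 => c /(_ setT HT (@subsetT _ _)).
  by rewrite probability_setT lee_fin.
have inv_gt0 n : 0 < n.+1%:R^-1 :> R by rewrite invr_gt0.
have /choice[C /choice[xi CP]] : forall n, exists C (xi : T -> V),
    [/\ H C, ((sup S - n.+1%:R^-1)%:E <= P C)%E, random_element H xi &
    forall w, C w -> G (w, xi w)].
  move=> n; have [c Sc lt] := sup_adherent (inv_gt0 n) supS.
  exact: selection_outer_ge Sc lt.
have /choice[B BP] : forall n, exists B, [/\ H B, projection G `<=` B &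
    (P B < (sup S + n.+1%:R^-1)%:E)%E].
  move=> n; apply: contrapT => nB.
  have : S (sup S + n.+1%:R^-1).
    move=> B HB GB; rewrite leNgt; apply/negP => PB; apply: nB; by exists B.
  by move=> /(sup_upper_bound supS); rewrite gerDl leNgt inv_gt0.
pose D := [set w | exists n, C n w].
have HD : H D by apply: (sa_ex sH) => n; have [] := CP n.
exists D, (fun w => xi (first (fun n => C n w)) w); split=> //.
- apply: (random_element_glue (label := fun w => first (fun n => C n w)) sH).
    by apply: (sa_first sH) => n; have [] := CP n.
  by move=> n; have [] := CP n.
- move=> w [n Cn]; have [Cf _] := @firstP (fun n => C n w) (ex_intro _ n Cn).
  by have [_ _ _] := CP (first (fun n => C n w)); apply.
exists (\bigcap_n (B n `\` D)); split.
- apply: bigcapT_measurable => n; apply: measurableD; last exact/HF.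
  by have [HB _ _] := BP n; exact/HF.
- apply/eqP; rewrite eq_le measure_ge0 andbT; apply/lee_addgt0Pr => e e0.
  have [n] : exists n : nat, 0 + n.+1%:R^-1 < e / 2.
    by apply: ltr_add_invr; rewrite divr_gt0.
  rewrite add0r add0e => ne; have [HB GB PB] := BP n; have [HC PC _ CG] := CP n.
  have mB := HF HB; have mC := HF HC.
  apply: (@le_trans _ _ (P (B n `\` C n))).
    apply: le_measure; rewrite ?inE; [|exact: measurableD|].
      apply: bigcapT_measurable => m; apply: measurableD; last exact/HF.
      by have [HBm _ _] := BP m; exact/HF.
    by move=> w /(_ n I)[Bw nD]; split=> // Cw; apply: nD; exists n.
  rewrite measureD//; last by rewrite (le_lt_trans (probability_le1 P _))// ltry.
  rewrite setIidr; last by move=> w /CG h; apply: GB; exists (xi n w).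
  rewrite leeBlDr; last by rewrite fin_num_measure.
  apply: (le_trans (ltW PB)); apply: le_trans (leeD2l _ PC).
  by rewrite -EFinD lee_fin addrCA lerD2l lerBrDr [e]splitr lerD// ltW.
- by move=> w [Gw nD] n _; split=> //; have [_ GB _] := BP n; exact: GB.
Qed.

End selection.

(** * Distances between random elements *)

Section distance.
Context {R : realType} {V : completeNormedModType R} {d : measure_display}
  {T : measurableType d}.
Hypothesis sepV : separable V.
Implicit Types (H : set (set T)) (xi eta : T -> V).

(** By separability, two points are at distance less than [e] iff some point of
    a dense sequence is within a rational [r] of one and within [e - r] of the
    other; this is a countable union of measurable events. *)
Lemma sa_dist_lt H xi eta (e : R) : sigma_algebra setT H ->
  random_element H xi -> random_element H eta ->
  H [set w | `|xi w - eta w| < e].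
Proof.
move=> sH /random_elementP hxi /random_elementP heta.
have [q dq] := separable_dense_seq sepV.
have near_q zeta (p : V) (r : R) : (forall U, open U -> H (zeta @^-1` U)) ->
    H [set w | `|zeta w - p| < r].
  move=> hz; rewrite (_ : mkset _ = zeta @^-1` ball p r); first exact/hz/ball_open.
  by apply/seteqP; split => w /=; rewrite -ball_normE /= distrC.
rewrite (_ : mkset _ = [set w | exists i : nat * rat,
    `|xi w - q i.1| < ratr i.2 /\ `|eta w - q i.1| < e - ratr i.2]).
  by apply: (sa_ex sH) => i; apply: (sa_and sH); apply: near_q; auto.
apply/seteqP; split=> w /=; last first.
  move=> [[i r] /= [h1 h2]]; rewrite -(subrKA (q i)) (le_lt_trans (ler_normD _ _))//.
  by rewrite -[ltRHS](subrKC (ratr r)) ltrD// distrC.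
move=> lt; pose del := (e - `|xi w - eta w|) / 3.
have del0 : 0 < del by rewrite divr_gt0// subr_gt0.
have [i iP] := dq (xi w) _ del0.
have [r /andP[r1 r2]] : exists r, (`|xi w - q i| < ratr r < `|xi w - q i| + del).
  have : `|xi w - q i| < `|xi w - q i| + del by rewrite ltrDl.
  by move=> /rat_in_itvoo[r]; rewrite in_itv /=; exists r.
exists (i, r); split=> //=.
have : `|eta w - q i| <= `|xi w - eta w| + `|xi w - q i|.
  by rewrite -(subrKA (xi w)) (le_trans (ler_normD _ _))// (distrC (eta w)).
move: iP r2; rewrite /del; lra.
Qed.

Lemma measurable_dist xi eta :
  random_element measurable xi -> random_element measurable eta ->
  measurable_fun setT (fun w => `|xi w - eta w|).
Proof.
move=> mxi meta.
apply: (measurability _ (RGenInftyO.measurableE R)).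
move=> _ [_ [x ->] <-]; rewrite setTI (_ : _ @^-1` _ = [set w | `|xi w - eta w| < x]).
  by apply: sa_dist_lt => //; exact: sigma_algebra_measurable.
by apply/seteqP; split => w /=; rewrite in_itv.
Qed.

End distance.

(** * Integrals of simple elements *)

Lemma ereal_cvg_lt {R : realType} (u : nat -> \bar R) l a :
  u n @[n --> \oo] --> l -> (l < a)%E -> \forall n \near \oo, (u n < a)%E.
Proof.
move=> ul la; apply: (ul [set x | (x < a)%E]); apply: open_nbhs_nbhs; split=> //.
exact: open_ereal_lt_ereal.
Qed.

Lemma ereal_cvg_gt {R : realType} (u : nat -> \bar R) l a :
  u n @[n --> \oo] --> l -> (a < l)%E -> \forall n \near \oo, (a < u n)%E.
Proof.
move=> ul la; apply: (ul [set x | (a < x)%E]); apply: open_nbhs_nbhs; split=> //.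
exact: open_ereal_gt_ereal.
Qed.

Section bochner.
Context {R : realType} {V : completeNormedModType R} {d : measure_display}
  {T : measurableType d}.
Variable P : probability T R.
Implicit Types (xi eta s t : T -> V).

Let sF : sigma_algebra setT (@measurable _ T) := sigma_algebra_measurable T.

(** Simple elements are used in the form [g \o l] with [l] a finite measurable
    labelling. Two of them can then be compared through the pair of their
    labels, and [g] need not be injective. *)
Definition label {I : Type} (l : T -> I) := forall i, measurable [set w | l w = i].

Lemma integral_label (I : finType) (l : T -> I) (r : I -> R) :
  label l -> (forall i, 0 <= r i) ->
  (\int[P]_w (r (l w))%:E = (\sum_i fine (P [set w | l w = i]) * r i)%:E)%E.
Proof.
move=> ml r0.
have E w : (r (l w))%:E = (\sum_i (r i)%:E * (\1_[set w | l w = i] w)%:E)%E.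
  rewrite (bigD1 (l w))//= indicE mem_set// mule1 big1 ?adde0// => i /eqP il.
  by rewrite indicE memNset ?mule0//= => /esym.
under eq_integral do rewrite E.
rewrite ge0_integral_sum//; last first.
- by move=> i w _; rewrite mule_ge0// lee_fin.
- move=> i; apply: measurable_funeM; apply/measurable_EFinP.
  exact: measurable_indic.
rewrite -sumEFin; apply: eq_bigr => i _.
rewrite ge0_integralZl ?lee_fin//; last first.
  by apply/measurable_EFinP; exact: measurable_indic.
by rewrite integral_indic// setIT EFinM fineK ?fin_num_measure// muleC.
Qed.

(** The definition sums over values, the right-hand side over labels: labels
    with the same value are grouped by exchanging two sums. *)
Lemma simple_integral_label (I : finType) (l : T -> I) (g : I -> V) :
  label l ->
  simple_integral P (fun w => g (l w)) = \sum_i fine (P [set w | l w = i]) *: g i.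
Proof.
move=> ml; pose s w := g (l w).
have fs : finite_set (range s).
  apply: (@sub_finite_set _ _ (g @` setT)); last exact: finite_image.
  by move=> _ [w _ <-]; exists (l w).
have Px x : fine (P (s @^-1` [set x])) =
    \sum_i fine (P [set w | l w = i]) * (g i == x)%:R.
  rewrite -[RHS]/(fine (_%:E)) -integral_label//.
  congr (fine _); rewrite -[s @^-1` _]setIT -(integral_indic P measurableT)//; last first.
    by apply: (@sa_fibers _ _ sF _ l (fun i => g i = x)) => i; exact: ml.
  apply: eq_integral => w _; rewrite indicE; congr ((_ : bool)%:R%:E).
  by apply/idP/eqP; rewrite inE.
rewrite /simple_integral -/s fsbig_finite//=.
under eq_bigr do rewrite Px scaler_suml.
rewrite exchange_big/=; apply: eq_bigr => i _.
under eq_bigr do rewrite -scalerA.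
have [gs|ngs] := boolP (g i \in finmap.enum_fset (fset_set (range s))).
  rewrite (bigD1_seq _ gs (finmap.fset_uniq _))/= eqxx scale1r big1 ?addr0// => x /negbTE.
  by rewrite eq_sym => ->; rewrite scale0r scaler0.
rewrite (_ : [set w | l w = i] = set0) ?measure0 ?scale0r.
  by rewrite big1// => x _; rewrite scale0r.
apply/seteqP; split=> // w /= lwi; move: ngs; rewrite in_fset_set// => /negP; apply.
by rewrite inE; exists w => //; rewrite /s lwi.
Qed.

Lemma simple_element_label s : simple_element s ->
  exists n (l : T -> 'I_n.+1) (g : 'I_n.+1 -> V), label l /\ s = fun w => g (l w).
Proof.
move=> [ms fs]; move/finite_seqP: (fs) => [r0 r0E].
have [r ur rE] : exists2 r, uniq r & range s = [set` r].
  by exists (undup r0); [exact: undup_uniq|rewrite r0E; apply/seteqP; split => x /=;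
    rewrite mem_undup].
have sr w : s w \in r by have : range s (s w) by [exists w]; rewrite rE.
exists (size r), (fun w => inord (index (s w) r)), (fun i => nth 0 r i).
have E w : (inord (index (s w) r) : 'I_(size r).+1) = index (s w) r :> nat.
  by rewrite inordK// ltnW// ltnS index_mem.
split; last by apply/funext => w; rewrite E nth_index.
move=> i; have [ir|ir] := ltnP i (size r).
  rewrite (_ : mkset _ = ~` (s @^-1` (~` [set nth 0 r i]))).
    apply: measurableC; move/random_elementP: ms; apply => //.
    by apply/closed_openC/accessible_closed_set1/hausdorff_accessible/norm_hausdorff.
  apply/seteqP; split=> w /=.
    by move=> /(congr1 val) /=; rewrite E => <-; rewrite nth_index.
  move/contrapT => sw; apply/val_inj; rewrite /= E sw; exact: index_uniq.
rewrite (_ : mkset _ = set0)//; apply/seteqP; split=> // w /= /(congr1 val) /=.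
by rewrite E => wi; move: ir; rewrite -wi leqNgt index_mem sr.
Qed.

Lemma label_simple_element (I : finType) (l : T -> I) (g : I -> V) :
  label l -> simple_element (fun w => g (l w)).
Proof.
move=> ml; split.
  by apply: (random_element_glue (xi := fun i => cst (g i)) sF) => // i;
    exact: random_element_cst.
apply: (@sub_finite_set _ _ (g @` setT)); last exact: finite_image.
by move=> _ [w _ <-]; exists (l w).
Qed.

Lemma simple_integral_dist s t : simple_element s -> simple_element t ->
  (`|simple_integral P s - simple_integral P t|%:E <= \int[P]_w `|s w - t w|%:E)%E.
Proof.
move=> /simple_element_label[n [l [g [ml ->]]]] /simple_element_label[m [k [h [mk ->]]]].
pose lk w := (l w, k w).
have mlk : label lk.
  move=> [i j]; rewrite (_ : mkset _ = [set w | l w = i] `&` [set w | k w = j]).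
    exact: measurableI.
  by apply/seteqP; split => w /= [<- <-].
rewrite (@simple_integral_label _ lk (fun p => g p.1) mlk).
rewrite (@simple_integral_label _ lk (fun p => h p.2) mlk).
rewrite (@integral_label _ lk (fun p => `|g p.1 - h p.2|))// lee_fin.
rewrite -sumrB (le_trans (ler_norm_sum _ _ _))//; apply: ler_sum => p _.
by rewrite -scalerBr normrZ ger0_norm// fine_ge0.
Qed.

Hypothesis sepV : separable V.

Lemma measurable_distE xi eta :
  random_element measurable xi -> random_element measurable eta ->
  measurable_fun setT (fun w => (`|xi w - eta w|)%:E).
Proof. by move=> mxi meta; apply/measurable_EFinP; exact: measurable_dist. Qed.

Lemma measurable_norm_element xi :
  random_element measurable xi -> measurable_fun setT (fun w => `|xi w|).
Proof.
move=> mxi; have := measurable_dist sepV mxi (random_element_cst 0 sF).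
by congr measurable_fun; apply/funext => w; rewrite subr0.
Qed.

Lemma integral_dist_triangle xi eta zeta :
  random_element measurable xi -> random_element measurable eta ->
  random_element measurable zeta ->
  (\int[P]_w (`|xi w - zeta w|)%:E <=
   \int[P]_w (`|xi w - eta w|)%:E + \int[P]_w (`|eta w - zeta w|)%:E)%E.
Proof.
move=> mxi meta mzeta.
rewrite -ge0_integralD//; try exact: measurable_distE.
apply: ge0_le_integral => //; [exact: measurable_distE| |].
  by apply: emeasurable_funD; exact: measurable_distE.
by move=> w _; rewrite -EFinD lee_fin -(subrKA (eta w)) ler_normD.
Qed.

(** Bochner integrals are located by comparing the integrand with a well-chosen
    simple element. The approximating sequence in the definition converges in
    mean, so the bound for simple elements passes to the limit. *)
Lemma bochner_integral_dist xi v t : is_bochner_integral P xi v -> simple_element t ->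
  (`|v - simple_integral P t|%:E <= \int[P]_w `|xi w - t w|%:E)%E.
Proof.
move=> [mxi [s [ss s0 sv]]] st; apply/lee_addgt0Pr => e e0.
have e2 : 0 < e / 2 by rewrite divr_gt0.
near \oo => n.
have h1 : `|v - simple_integral P (s n)| <= e / 2.
  by near: n; apply: cvgr_dist_le.
have h2 : (\int[P]_w (`|xi w - s n w|)%:E < (e / 2)%:E)%E.
  by near: n; apply: ereal_cvg_lt s0 _; rewrite lte_fin.
rewrite -(subrKA (simple_integral P (s n))).
apply: le_trans (_ : ((e/2)%:E + `|simple_integral P (s n) - simple_integral P t|%:E <= _)%E).
  by rewrite -EFinD lee_fin (le_trans (ler_normD _ _))// lerD2r.
rewrite [in leRHS](splitr e) EFinD addeA [leRHS]addeC leeD2l//.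
apply: (le_trans (simple_integral_dist (ss n) st)).
have [msn _] := ss n; have [mt _] := st.
apply: (le_trans (integral_dist_triangle msn mxi mt)); rewrite addeC leeD2l//.
by under eq_integral do rewrite distrC; exact: ltW.
Unshelve. all: by end_near. Qed.

(** The sets [l >= K] decrease to the empty set. *)
Lemma integral_tail (f : T -> \bar R) (l : T -> nat) (e : R) :
  label l -> measurable_fun setT f -> (forall w, 0 <= f w)%E ->
  (\int[P]_w f w < +oo)%E -> 0 < e ->
  exists K, (\int[P]_(w in [set w | (K <= l w)%N]) f w < e%:E)%E.
Proof.
move=> ml mf f0 fi e0.
have mlt n : measurable [set w | (l w < n)%N].
  by apply: (@sa_fibers _ _ sF _ l (fun i => (i < n)%N)) => i; exact: ml.
have mge n : measurable [set w | (n <= l w)%N].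
  by apply: (@sa_fibers _ _ sF _ l (fun i => (n <= i)%N)) => i; exact: ml.
have cvgI : (\int[P]_(w in [set w | (l w < n)%N]) f w)%E @[n --> \oo] -->
    (\int[P]_w f w)%E.
  have <- : \bigcup_n [set w | (l w < n)%N] = setT.
    by apply/seteqP; split=> // w _; exists (l w).+1 => /=.
  apply: ge0_nondecreasing_set_cvg_integral => //.
    by move=> n m nm; apply/subsetPset => w /= /leq_trans; apply.
  by move=> n; exact: measurable_funS mf.
have finI : (\int[P]_w f w)%E \is a fin_num by rewrite ge0_fin_numE// integral_ge0.
have [K] : exists K, (\int[P]_w f w - e%:E < \int[P]_(w in [set w | (l w < K)%N]) f w)%E.
  near \oo => n; exists n; near: n; apply: ereal_cvg_gt cvgI _.
  by rewrite lteBlDr// lteDl// lte_fin.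
move=> KP; exists K; move: KP.
have -> : (\int[P]_w f w = \int[P]_(w in [set w | (l w < K)%N]) f w +
    \int[P]_(w in [set w | (K <= l w)%N]) f w)%E.
  rewrite -ge0_integral_setU//.
  - congr (integral _ _ _); apply/seteqP; split => // w _ /=.
    by case: (ltnP (l w) K); [left|right].
  - exact: measurable_funS mf.
  - apply/disj_setPS => w [/= h1 h2]; by rewrite ltnNge h2 in h1.
have fin1 : (\int[P]_(w in [set w | (l w < K)%N]) f w)%E \is a fin_num.
  rewrite ge0_fin_numE ?integral_ge0//; apply: le_lt_trans fi.
  exact: ge0_subset_integral.
by rewrite lteBlDr// lteD2lE.
Unshelve. all: by end_near. Qed.

End bochner.

(** * Existence of Bochner integrals *)

Section bochner_existence.
Context {R : realType} {V : completeNormedModType R} {d : measure_display}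
  {T : measurableType d}.
Variable P : probability T R.
Implicit Types (xi eta s t : T -> V).
Hypothesis sepV : separable V.

Let sF : sigma_algebra setT (@measurable _ T) := sigma_algebra_measurable T.

(** The shape of the rounding errors below: uniformly small on [A], integrably
    small on the tail [D]. *)
Lemma integral_le_split (h f : T -> R) (A D : set T) (e : R) :
  measurable A -> measurable D ->
  measurable_fun setT h -> measurable_fun setT f ->
  (forall w, 0 <= h w) -> (forall w, 0 <= f w) -> 0 <= e ->
  (forall w, h w <= e * \1_A w + f w * \1_D w) ->
  (\int[P]_w (h w)%:E <= e%:E * P A + \int[P]_(w in D) (f w)%:E)%E.
Proof.
move=> mA mD mh mf h0 f0 e0 hle.
have m1 : measurable_fun setT (fun w => (e * \1_A w)%:E).
  by apply/measurable_EFinP; apply: measurable_funM => //; exact: measurable_indic.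
have m2 : measurable_fun setT (fun w => (f w * \1_D w)%:E).
  by apply/measurable_EFinP; apply: measurable_funM => //; exact: measurable_indic.
have p1 w : (0 <= (e * \1_A w)%:E)%E by rewrite lee_fin mulr_ge0.
have p2 w : (0 <= (f w * \1_D w)%:E)%E by rewrite lee_fin mulr_ge0.
apply: (@le_trans _ _ (\int[P]_w ((e * \1_A w)%:E + (f w * \1_D w)%:E))%E).
  apply: ge0_le_integral => //.
  - by move=> w _; rewrite lee_fin.
  - exact/measurable_EFinP.
  - exact: emeasurable_funD.
  - by move=> w _; rewrite -EFinD lee_fin.
rewrite ge0_integralD//.
have -> : (\int[P]_w (e * \1_A w)%:E = e%:E * P A)%E.
  under eq_integral do rewrite EFinM.
  rewrite ge0_integralZl ?lee_fin//; last first.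
    by apply/measurable_EFinP; exact: measurable_indic.
  by rewrite integral_indic// setIT.
rewrite leeD2l// [leRHS]integral_mkcond le_eqVlt; apply/orP; left; apply/eqP; apply: eq_integral => w _.
by rewrite patchE indicE; case: ifP => _; rewrite ?mulr1// mulr0.
Qed.

(** Round [xi] to the first point of the dense sequence within [e / 2], and to
    0 where that point has a large index. *)
Lemma simple_approximation xi e : bochner_integrable P xi -> 0 < e ->
  exists s, simple_element s /\ (\int[P]_w (`|xi w - s w|)%:E < e%:E)%E.
Proof.
move=> [mxi ixi] e0; have [q dq] := separable_dense_seq sepV.
have e2 : 0 < e / 2 by rewrite divr_gt0.
pose l w := first (fun i => `|xi w - q i| < e / 2).
have ml : label l.
  apply: (sa_first sF) => i.
  exact: (sa_dist_lt sepV (e / 2) sF mxi (random_element_cst (q i) sF)).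
have mnorm := measurable_norm_element sepV mxi.
have [K tailK] := integral_tail ml ((measurable_EFinP _ _).2 mnorm)
  (fun w => normr_ge0 (xi w)) ixi e2.
pose k w : 'I_K.+1 := inord (minn (l w) K).
pose g (i : 'I_K.+1) := if (i < K)%N then q i else 0.
have mk : label k by move=> i; exact: (@sa_fibers _ _ sF _ l
   (fun j => inord (minn j K) = i)).
have kE w : k w = minn (l w) K :> nat by rewrite inordK// ltnS geq_minr.
exists (fun w => g (k w)); split; first exact: label_simple_element.
have mge : measurable [set w | (K <= l w)%N].
  exact: (@sa_fibers _ _ sF _ l (fun i => (K <= i)%N)).
have [ms _] := label_simple_element g mk.
apply: (@le_lt_trans _ _ ((e / 2)%:E * P setT +
    \int[P]_(w in [set w | (K <= l w)%N]) (`|xi w|)%:E)%E).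
  apply: integral_le_split => //; [exact: measurable_dist|exact: ltW|].
  move=> w; rewrite indicE mem_set// mulr1 indicE /g kE.
  have [lK|lK] := ltnP (l w) K.
    rewrite memNset; last by rewrite /= leqNgt lK.
    rewrite mulr0 addr0 lK.
    have [h _] := @firstP (fun i => `|xi w - q i| < e / 2) (dq (xi w) _ e2).
    exact: ltW.
  by rewrite mem_set// mulr1 ltnn subr0 lerDr ltW.
by rewrite probability_setT mule1 [in ltRHS](splitr e) EFinD lteD2lE.
Qed.

(** The integrals of the approximating simple elements form a Cauchy sequence,
    and [V] is complete. *)
Lemma bochner_integral_exists xi : bochner_integrable P xi ->
  exists v, is_bochner_integral P xi v.
Proof.
move=> bxi; have [mxi _] := bxi.
have inv_gt0 n : 0 < n.+1%:R^-1 :> R by rewrite invr_gt0.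
have /choice[s sP] : forall n : nat, exists s, simple_element s /\
    (\int[P]_w (`|xi w - s w|)%:E < n.+1%:R^-1%:E)%E.
  by move=> n; exact: simple_approximation.
have ss n : simple_element (s n) by have [] := sP n.
have ms n : random_element measurable (s n) by have [] := ss n.
have cSI : cvg (simple_integral P (s n) @[n --> \oo]).
  apply: cauchy_cvg; apply: cauchy_exP => e e0.
  have e2 : 0 < e / 2 by rewrite divr_gt0.
  have [N] := ltr_add_invr e2; rewrite add0r => Ne.
  exists (simple_integral P (s N)); exists N => // n /= Nn.
  rewrite -ball_normE /= -lte_fin.
  apply: (le_lt_trans (simple_integral_dist P (ss N) (ss n))).
  apply: (le_lt_trans (integral_dist_triangle P sepV (ms N) mxi (ms n))).
  rewrite (splitr e) EFinD lteD//.
    under eq_integral do rewrite distrC.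
    by have [_ /lt_trans] := sP N; apply; rewrite lte_fin.
  have [_ /lt_le_trans] := sP n; apply; rewrite lee_fin (le_trans _ (ltW Ne))//.
  by rewrite lef_pV2 ?posrE// ler_nat.
exists (lim (simple_integral P (s n) @[n --> \oo])); split=> //; exists s; split=> //.
apply: (@squeeze_cvge _ _ _ _ (cst 0%E) _ (fun n => n.+1%:R^-1%:E)).
- near=> n; rewrite integral_ge0 ?lee_fin//=; apply: ltW; by have [] := sP n.
- exact: cvg_cst.
- apply: cvg_EFin; first exact: nearW.
  exact: (@cvg_harmonic R).
Unshelve. all: by end_near. Qed.

End bochner_existence.

Section restriction.
Context {R : realType} {V : completeNormedModType R} {d : measure_display}
  {T : measurableType d}.
Variable P : probability T R.
Implicit Types (xi : T -> V) (H : set (set T)).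

Lemma restrict_eltE (A : set T) xi w : A w -> restrict_elt (R := R) A xi w = xi w.
Proof. by move=> Aw; rewrite /restrict_elt indicE mem_set// scale1r. Qed.

Lemma restrict_eltN (A : set T) xi w : ~ A w -> restrict_elt (R := R) A xi w = 0.
Proof. by move=> Aw; rewrite /restrict_elt indicE memNset// scale0r. Qed.

Lemma restrict_elt_setI (A B : set T) xi :
  restrict_elt A (restrict_elt B xi) = restrict_elt (R := R) (A `&` B) xi.
Proof. by apply/funext => w; rewrite /restrict_elt indicI scalerA. Qed.

Lemma random_element_restrict H (A : set T) xi : sigma_algebra setT H ->
  H A -> random_element H xi -> random_element H (restrict_elt (R := R) A xi).
Proof.
move=> sH HA mxi.
rewrite (_ : restrict_elt A xi = fun w => (if w \in A then xi else cst 0) w).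
  by apply: random_element_if => //; exact: random_element_cst.
apply/funext => w; case: ifPn => [/set_mem|/negP nA]; first exact: restrict_eltE.
by rewrite restrict_eltN// => /mem_set.
Qed.

Lemma bochner_integrable_restrict (A : set T) xi : separable V -> measurable A ->
  bochner_integrable P xi -> bochner_integrable P (restrict_elt A xi).
Proof.
move=> sepV mA [mxi ixi].
have sF := sigma_algebra_measurable T.
have mA' := random_element_restrict sF mA mxi.
split=> //; apply: le_lt_trans ixi; apply: ge0_le_integral => //.
- by apply/measurable_EFinP; exact: measurable_norm_element.
- by apply/measurable_EFinP; exact: measurable_norm_element.
- move=> w _; rewrite lee_fin; have [Aw|nAw] := pselect (A w).
    by rewrite restrict_eltE.
  by rewrite restrict_eltN// normr0.
Qed.

Lemma bochner_integrable_bounded xi (M : R) : separable V ->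
  random_element measurable xi -> (forall w, `|xi w| <= M) -> bochner_integrable P xi.
Proof.
move=> sepV mxi xiM; split=> //.
apply: (@le_lt_trans _ _ (\int[P]_w M%:E)%E).
  apply: ge0_le_integral => //.
    by apply/measurable_EFinP; exact: measurable_norm_element.
  by move=> w _; rewrite lee_fin.
rewrite integral_cst// -[(_ < _)%E]/((M%:E * P setT < +oo)%E).
by rewrite probability_setT mule1 ltry.
Qed.

End restriction.

(** * Convex combinations *)

Lemma convex_setP {R : realType} {V : completeNormedModType R} (K : set V) x y (t : R) :
  convex_set K -> K x -> K y -> 0 <= t <= 1 -> K (t *: x + (1 - t) *: y).
Proof.
move=> cK Kx Ky /andP[t0 t1].
have := cK x y (Itv01 t0 t1); rewrite !inE => /(_ Kx Ky).
by [].
Qed.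

(** Normalising by the total weight inside the statement lets the induction go
    through for weights that do not sum to 1. *)
Lemma convex_combination {R : realType} {V : completeNormedModType R} (K : set V)
    {I : eqType} (r : seq I) (p : I -> R) (x : I -> V) :
  convex_set K -> (forall i, 0 <= p i) -> (forall i, 0 < p i -> K (x i)) ->
  0 < \sum_(i <- r) p i ->
  K ((\sum_(i <- r) p i)^-1 *: \sum_(i <- r) p i *: x i).
Proof.
move=> cK p0 Kx; elim: r => [|i r IH]; first by rewrite big_nil ltxx.
rewrite !big_cons; set s := \sum_(j <- r) p j in IH *.
have s0 : 0 <= s by exact: sumr_ge0.
have [pi0|pi0] := eqVneq (p i) 0; first by rewrite pi0 scale0r !add0r.
have ppi : 0 < p i by rewrite lt_neqAle eq_sym pi0 p0.
have [sE0 _|sN0 ps] := eqVneq s 0.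
  have /allP all0 : all (fun j => true ==> (p j == 0)) r.
    by rewrite -psumr_eq0//; apply/eqP.
  rewrite sE0 addr0 big1_seq ?addr0; last first.
    by move=> j /andP[_ /all0] /= /eqP ->; rewrite scale0r.
  by rewrite scalerA mulVf// scale1r; exact: Kx.
have s_gt0 : 0 < s by rewrite lt_neqAle eq_sym sN0.
have Ks := IH s_gt0.
have := @convex_setP _ _ _ _ _ (p i / (p i + s)) cK (Kx i ppi) Ks.
have -> : 1 - p i / (p i + s) = s / (p i + s) by field; rewrite gt_eqF.
have ge0 : 0 <= p i / (p i + s) <= 1.
  by rewrite divr_ge0 ?addr_ge0//= ler_pdivrMr// mul1r lerDl.
move=> /(_ ge0); rewrite scalerDr !scalerA.
by congr (K (_ *: _ + _ *: _)); field; rewrite ?sN0 gt_eqF.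
Qed.

(** * Conditional expectations of selections *)

Section random_sets_lemmas.
Context {d : measure_display} {T : measurableType d} {R : realType}
  {V : completeNormedModType R}.
Variables (P : probability T R) (H : set (set T)).
Hypothesis (sH : sigma_algebra setT H) (HF : H `<=` measurable).
Hypothesis sepV : separable V.
Implicit Types (X : T -> set V) (xi eta zeta : T -> V).

Let sF : sigma_algebra setT (@measurable _ T) := sigma_algebra_measurable T.

Lemma sa_mem_random_set X xi : random_set H X -> random_element H xi ->
  H [set w | X w (xi w)].
Proof.
move=> mX mxi; rewrite -[H](sigma_algebra_id sH).
have mpair := @measurable_fun_pair _ _ _ (g_sigma_algebraType H)
  (g_sigma_algebraType H) (borel V) id xi (@measurable_id _ _ _) mxi.
by have := mpair measurableT _ mX; rewrite setTI.
Qed.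

(** The event that [X] meets a ball is a projection of a measurable set: by
    measurable selection it is a member of [H] up to a null set, but in general
    not itself a member. *)
Lemma measurable_hitting X (p : V) (r : R) : random_set H X ->
  exists D, [/\ H D, forall w, D w -> exists2 x, X w x & `|x - p| < r &
    P.-negligible ([set w | exists2 x, X w x & `|x - p| < r] `\` D)].
Proof.
move=> mX.
have mG : (measurable : set (set (g_sigma_algebraType H * borel V)))
    ([set u | X u.1 u.2] `&` (snd @^-1` ball p r)).
  apply: measurableI => //; rewrite -[_ @^-1` _]setTI.
  apply: (@measurable_snd _ _ (g_sigma_algebraType H) (borel V)) => //.
  by apply: sub_sigma_algebra; exact: ball_open.
have [D [xi [HD mxi Dxi negl]]] := measurable_selection P sH HF sepV mG.
exists D; split=> //.
  move=> w /Dxi[/= Xxi]; rewrite -ball_normE /= distrC => ?; by exists (xi w).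
apply: negligibleS negl => w [[x Xx xp] nD]; split=> //; exists x; split=> //=.
by rewrite -ball_normE /= distrC.
Qed.

(** Cut [C] successively by [D 0], ..., [D (K-1)]. Both sides of the inequality
    are additive, so at each cut it survives on one of the two halves. *)
Lemma split_atoms (D : nat -> set T) (m : set T -> \bar R) (del : R) (C : set T) K :
  (forall i, H (D i)) -> (forall A B, H A -> H B -> m A = m (A `&` B) + m (A `\` B))%E ->
  0 <= del -> H C -> (m C < del%:E * P C)%E ->
  exists C', [/\ H C', C' `<=` C, (m C' < del%:E * P C')%E &
    forall i, (i < K)%N -> C' `<=` D i \/ C' `&` D i = set0].
Proof.
move=> HD mD del0 HC mC; elim: K => [|K [C' [HC' C'C mC' split]]]; first by exists C; split.
have HI : H (C' `&` D K) by exact: sa_setI.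
have HB : H (C' `\` D K) by exact: sa_setD.
have mI := HF HI; have mB := HF HB.
have PC' : P C' = (P (C' `&` D K) + P (C' `\` D K))%E.
  by rewrite -measureU ?setUIDK// setDE setIACA setICr setI0.
have [lt|ge] := ltP (m (C' `&` D K)) (del%:E * P (C' `&` D K))%E.
  exists (C' `&` D K); split=> //; first by move=> w [/C'C].
  move=> i; rewrite ltnS leq_eqVlt => /predU1P[->|iK]; first by left => w [].
  have [h|h] := split _ iK; first by left => w [/h].
  by right; rewrite setIAC h set0I.
have [lt|ge'] := ltP (m (C' `\` D K)) (del%:E * P (C' `\` D K))%E.
  exists (C' `\` D K); split=> //; first by move=> w [/C'C].
  move=> i; rewrite ltnS leq_eqVlt => /predU1P[->|iK].
    by right; rewrite setDE -setIA setICl setI0.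
  have [h|h] := split _ iK; first by left => w [/h].
  by right; rewrite setDE setIAC h set0I.
move: mC'; rewrite (mD C' (D K))// PC' ge0_muleDr// => /lt_le_trans.
by move=> /(_ _ (leeD ge ge')); rewrite ltxx.
Qed.

(** The averaging argument: the average of [zeta] over a piece [C'] is also
    that of [xi], which rounding turns into a convex combination of points that
    are close to [X w] for every [w] in [C']. *)
Lemma condexp_ball_hits X xi A zeta C (q : V) (r e : R) :
  random_set H X -> random_element measurable xi -> {ae P, forall w, X w (xi w)} ->
  H A -> is_condexp P H (restrict_elt A xi) zeta ->
  H C -> C `<=` A -> (0 < P C)%E -> 0 <= r -> 0 < e ->
  (forall w, C w -> `|zeta w - q| <= r) ->
  exists C', [/\ H C', C' `<=` C, (0 < P C')%E &
    forall w, C' w -> convex_set (X w) -> exists2 y, X w y & `|y - q| < r + e].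
Proof.
move=> mX mxi Xxi HA [bxi mzeta bzeta cexp] HC CA PC0 r0 e0 zq.
have [c dc] := separable_dense_seq sepV.
(* four errors of size del: rounding of xi, its tail, points of X near the c i,
   and room for a strict inequality *)
have [del del0 delE] : exists2 del : R, 0 < del & del = e / 4.
  by exists (e / 4) => //; rewrite divr_gt0.
have /choice[D DP] : forall i, exists D, [/\ H D,
    forall w, D w -> exists2 x, X w x & `|x - c i| < del &
    P.-negligible ([set w | exists2 x, X w x & `|x - c i| < del] `\` D)].
  by move=> i; exact: measurable_hitting.
have HD i : H (D i) by have [] := DP i.
pose l w := first (fun i => `|xi w - c i| < del).
have lP w : `|xi w - c (l w)| < del.
  by have [] := @firstP (fun i => `|xi w - c i| < del) (dc (xi w) _ del0).
have ml : label l.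
  apply: (sa_first sF) => i.
  exact: (sa_dist_lt sepV del sF mxi (random_element_cst (c i) sF)).
(* xi being close to c i forces X to meet the ball around c i *)
have neglD i : P.-negligible ([set w | l w = i] `\` D i).
  have [_ _ negl] := DP i; apply: negligibleS (negligibleU Xxi negl).
  move=> w [/= lwi nD]; have [Xw|nX] := pselect (X w (xi w)); last by left.
  by right; split=> //; exists (xi w) => //; rewrite -lwi.
(* a fixed point near X throughout a non-null part of C: it replaces the points
   of the dense sequence with a large index *)
have [i0 PCD] : exists i, (0 < P (C `&` D i))%E.
  apply: contrapT => /forallNP nP.
  have : P.-negligible C.
    apply: negligibleS (_ : P.-negligible (\bigcup_i (C `&` D i) `|`
        \bigcup_i ([set w | l w = i] `\` D i))).
      move=> w Cw; have [Dw|nDw] := pselect (D (l w) w).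
        by left; exists (l w).
      by right; exists (l w).
    apply: negligibleU; apply: negligible_bigcup => // i.
    have mCD : measurable (C `&` D i) by apply: measurableI; exact/HF.
    apply/negligibleP => //; apply/eqP; rewrite eq_le measure_ge0 andbT leNgt.
    by apply/negP/nP.
  move=> /negligibleP => /(_ (HF HC)) PC; by rewrite PC ltxx in PC0.
pose C1 := C `&` D i0.
have HC1 : H C1 by exact: sa_setI.
have C1A : C1 `<=` A by move=> w [/CA].
have bxi1 : bochner_integrable P (restrict_elt C1 xi).
  rewrite -(_ : C1 `&` A = C1); last by apply/setIidPl.
  by rewrite -restrict_elt_setI; apply: bochner_integrable_restrict => //; exact/HF.
pose near_c w := restrict_elt (R := R) C1 (cst (c i0)) w.
have mnear_c : random_element measurable near_c.
  by apply: random_element_restrict => //; [exact/HF|exact: random_element_cst].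
pose f w := `|restrict_elt (R := R) C1 xi w - near_c w|.
have [mxi1 ixi1] := bxi1.
have mf : measurable_fun setT f by exact: measurable_dist.
have f0 w : 0 <= f w by exact: normr_ge0.
have ifin : (\int[P]_w (f w)%:E < +oo)%E.
  have m0 := random_element_cst (T := T) (0 : V) sF.
  apply: le_lt_trans (integral_dist_triangle P sepV mxi1 m0 mnear_c) _.
  apply: lte_add_pinfty; first by under eq_integral do rewrite subr0.
  under eq_integral do rewrite distrC subr0.
  have [|_] // := bochner_integrable_bounded P (M := `|c i0|) sepV mnear_c.
  move=> w; have [Cw|nCw] := pselect (C1 w); first by rewrite /near_c restrict_eltE.
  by rewrite /near_c restrict_eltN// normr0.
have PC1 : (0 < del * fine (P C1)).
  by rewrite mulr_gt0// fine_gt0// PCD (le_lt_trans (probability_le1 P _))//;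
    [exact/HF|exact: ltry].
have [K tailK] := integral_tail ml ((measurable_EFinP _ _).2 mf)
  (fun w => f0 w) ifin PC1.
pose tail := [set w | (K <= l w)%N].
have mtail : measurable tail by exact: (@sa_fibers _ _ sF _ l (fun i => (K <= i)%N)).
pose m (B : set T) := (\int[P]_(w in B `&` tail) (f w)%:E)%E.
have mE : measurable_fun setT (EFin \o f) by exact/measurable_EFinP.
have [||||C' [HC' C'C1 mC'1 split]] := @split_atoms D m del C1 K HD.
- move=> A' B HA' HB; rewrite /m -ge0_integral_setU//.
  + by rewrite -setIUl setUIDK.
  + by apply: measurableI => //; apply: measurableI; exact/HF.
  + by apply: measurableI => //; apply: measurableD; exact/HF.
  + exact: measurable_funS mE.
  + by move=> w _; rewrite lee_fin.
  + by apply/disj_setPS => w [[[_ /= h1] _] [[_ h2] _]]; case: h2.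
- exact: ltW.
- exact: HC1.
- have PC1fin : P C1 \is a fin_num by rewrite fin_num_measure//; exact/HF.
  rewrite -(fineK PC1fin) -EFinM; apply: le_lt_trans tailK.
  apply: ge0_subset_integral => //.
  + by apply: measurableI => //; exact/HF.
  + exact: measurable_funS mE.
  + by move=> w _; rewrite lee_fin.
have mC' := HF HC'.
have PC'0 : 0 < fine (P C').
  rewrite lt_neqAle fine_ge0// andbT eq_sym; apply/negP => /eqP PC'E.
  have PC'E0 : P C' = 0%E.
    by rewrite -[LHS]fineK ?PC'E//; exact: fin_num_measure.
  move: mC'1; rewrite PC'E0 mule0 ltNge integral_ge0// => w _.
  by rewrite lee_fin.
have [v [xiv zetav]] := cexp C' HC'.
have C'A : C' `<=` A by move=> w /C'C1/C1A.
rewrite restrict_elt_setI (_ : C' `&` A = C') in xiv; last by apply/setIidPl.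
(* labels: an index below K for the approximated part of C', K for its tail,
   and K.+1 outside C' *)
pose k w : 'I_K.+2 := if w \in C' then inord (minn (l w) K) else ord_max.
have kE w : C' w -> k w = minn (l w) K :> nat.
  by move=> Cw; rewrite /k mem_set// inordK// ltnS (leq_trans (geq_minr _ _)).
have kN w : ~ C' w -> k w = K.+1 :> nat by move=> nC; rewrite /k memNset.
have kin w : (k w <= K)%N = (w \in C').
  have [Cw|nCw] := pselect (C' w); first by rewrite kE// geq_minr mem_set.
  by rewrite kN// ltnn memNset.
have mk : label k.
  move=> i; rewrite (_ : mkset _ = [set w | if w \in C' then
    (inord (minn (l w) K) : 'I_K.+2) = i else ord_max = i]).
    rewrite (_ : mkset _ = [set w | (C' w /\ (inord (minn (l w) K) : 'I_K.+2) = i) \/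
      (~ C' w /\ ord_max = i)]).
      apply: (sa_or sF); apply: (sa_and sF) => //.
      + exact: (@sa_fibers _ _ sF _ l (fun j => (inord (minn j K) : 'I_K.+2) = i)).
      + exact: (sa_not sF).
      + exact: (sa_cst sF).
    apply/seteqP; split => w /=.
      by case: ifPn => [/set_mem|/negP nC ?]; [left|right; split=> // /mem_set].
    by move=> [[Cw ?]|[nC ?]]; [rewrite mem_set|rewrite memNset].
  by apply/seteqP; split => w /=; rewrite /k; case: ifP.
pose p (i : 'I_K.+2) := if (i <= K)%N then fine (P [set w | k w = i]) else 0.
have p0 i : 0 <= p i by rewrite /p; case: ifP => // _; exact: fine_ge0.
pose sig := \sum_i p i.
have sigE : sig = fine (P C').
  have : (\int[P]_w (\1_C' w)%:E = sig%:E)%E.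
    rewrite /sig; transitivity (\int[P]_w ((k w <= K)%N%:R)%:E)%E.
      by apply: eq_integral => w _; rewrite kin indicE.
    rewrite (@integral_label _ _ _ P _ k (fun i => (i <= K)%N%:R) mk)//.
    by congr (_%:E); apply: eq_bigr => i _; rewrite /p; case: ifP; rewrite ?mulr1 ?mulr0.
  by rewrite integral_indic// setIT => ->.
have SIE (a : 'I_K.+2 -> V) :
    simple_integral P (fun w => if (k w <= K)%N then a (k w) else 0) = \sum_i p i *: a i.
  rewrite (@simple_integral_label _ _ _ _ P _ k (fun i => if (i <= K)%N then a i else 0) mk).
  by apply: eq_bigr => i _; rewrite /p; case: ifP; rewrite ?scaler0 ?scale0r.
have simpleE (a : 'I_K.+2 -> V) :
    simple_element (fun w => if (k w <= K)%N then a (k w) else 0).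
  exact: (label_simple_element (fun i : 'I_K.+2 => if (i <= K)%N then a i else 0) mk).
pose a (i : 'I_K.+2) := if (i < K)%N then c i else c i0.
have PC'fin : P C' \is a fin_num by exact: fin_num_measure.
have mxiC' : random_element measurable (restrict_elt C' xi).
  exact: random_element_restrict.
have mzetaC' : random_element measurable (restrict_elt C' zeta).
  apply: random_element_restrict => //; exact: random_elementS mzeta.
(* v / sig is the average over C' of both xi and zeta *)
have v_near_a : `|v - \sum_i p i *: a i| <= del * sig + del * sig.
  have := bochner_integral_dist sepV xiv (simpleE a); rewrite SIE => h.
  rewrite -lee_fin; apply: (le_trans h).
  apply: (@le_trans _ _ (del%:E * P C' + m C')%E).
    apply: integral_le_split => //.
    - exact: measurableI.
    - by apply: measurable_dist => //; have [] := simpleE a.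
    - exact: ltW.
    move=> w; rewrite kin; have [Cw|nCw] := pselect (C' w); last first.
      rewrite memNset// restrict_eltN// subr0 normr0 !indicE memNset//.
      by rewrite memNset ?mulr0 ?addr0// => -[].
    rewrite mem_set// restrict_eltE// !indicE mem_set// mulr1 /a kE//.
    have [lK|lK] := ltnP (l w) K.
      by rewrite lK memNset ?mulr0 ?addr0 ?ltW//= => -[_]; rewrite /tail /= leqNgt lK.
    rewrite ltnn mem_set// mulr1 /f /near_c !restrict_eltE//; try exact: C'C1.
    by rewrite lerDr ltW.
  rewrite sigE EFinD EFinM; rewrite fineK//; apply: leeD => //.
  exact: ltW.
have v_near_q : `|v - sig *: q| <= r * sig.
  have := bochner_integral_dist sepV zetav (simpleE (cst q)); rewrite SIE => h.
  rewrite scaler_suml -lee_fin; apply: (le_trans h).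
  apply: (@le_trans _ _ (r%:E * P C' + \int[P]_(w in set0) (cst 0 w)%:E)%E).
    apply: (@integral_le_split _ _ _ P _ (cst 0) C' set0 r) => //.
      by apply: measurable_dist => //; have [] := simpleE (cst q).
    move=> w; rewrite kin; have [Cw|nCw] := pselect (C' w); last first.
      by rewrite memNset// restrict_eltN// subr0 normr0 mul0r addr0 mulr_ge0.
    rewrite mem_set// restrict_eltE// indicE mem_set// mulr1 mul0r addr0 zq//.
    by have [] := C'C1 w Cw.
  by rewrite integral_set0 adde0 sigE EFinM fineK.
exists C'; split => //.
- by move=> w /C'C1[].
- by rewrite lt_neqAle measure_ge0 andbT eq_sym -(fineK PC'fin); rewrite eqe gt_eqF.
move=> w C'w cXw.
have /choice[x xP] : forall i, exists x, 0 < p i -> X w x /\ `|x - a i| < del.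
  move=> i; have [pi|pi] := ltP 0 (p i); last by exists 0.
  suff [x Xx xa] : exists2 x, X w x & `|x - a i| < del by exists x.
  have [_ Di0 _] := DP i0.
  rewrite /a; case: ifPn => iK; last by apply: Di0; have [] := C'C1 w C'w.
  have [_ Di _] := DP i; apply: Di.
  have [h|h] := split _ iK; first exact: h.
  exfalso; move: pi; rewrite /p (ltnW iK) (_ : P _ = 0%E) ?ltxx//.
  apply/negligibleP; first exact: mk.
  apply: negligibleS (neglD i) => w' /= kw'.
  have C'w' : C' w' by apply/set_mem; rewrite -kin kw' ltnW.
  have := kE w' C'w'; rewrite kw'; have [lK|lK] := ltnP (l w') K => e'; last first.
    by rewrite e' ltnn in iK.
  split; first by [].
  by move=> Dw'; have : set0 w' by rewrite -h; split.
have Xx i : 0 < p i -> X w (x i) by move=> /xP[].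
have sig0 : 0 < sig by rewrite sigE.
exists (sig^-1 *: \sum_i p i *: x i).
  exact: convex_combination.
have -> : sig^-1 *: (\sum_i p i *: x i) - q =
    sig^-1 *: (\sum_i p i *: x i - sig *: q).
  by rewrite scalerBr scalerA mulVf ?scale1r// gt_eqF.
rewrite normrZ gtr0_norm ?invr_gt0// mulrC ltr_pdivrMr//.
have x_near_a : `|\sum_i p i *: x i - \sum_i p i *: a i| <= del * sig.
  rewrite -sumrB (le_trans (ler_norm_sum _ _ _))// mulr_sumr; apply: ler_sum => i _.
  rewrite -scalerBr normrZ ger0_norm// mulrC.
  have [pi|pi] := ltP 0 (p i); first by rewrite ler_wpM2r// ltW//; have [] := xP i pi.
  by rewrite (_ : p i = 0) ?mulr0//; apply/eqP; rewrite eq_le pi p0.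
rewrite -(subrKA (\sum_i p i *: a i)) (le_lt_trans (ler_normD _ _))//.
rewrite -(subrKA v (\sum_i p i *: a i)).
apply: le_lt_trans (_ : del * sig + (2 * del * sig + r * sig) < _).
  rewrite lerD// (le_trans (ler_normD _ _))// lerD// distrC (le_trans v_near_a)//.
  by rewrite -mulrA mulr2n mulrDl mul1r.
rewrite delE; nra.
Qed.

(** Where [zeta w] is outside the closed set [X w], some ball with centre in
    the dense sequence and radius [1/(k+1)] contains [zeta w] while [X w]
    misses the ball of twice that radius. There are countably many such balls,
    and [condexp_ball_hits] shows that each of them accounts for a null set
    only. *)
Lemma condexp_mem X xi A zeta :
  random_set H X -> ae_closed P X -> ae_convex P X ->
  random_element measurable xi -> {ae P, forall w, X w (xi w)} ->
  H A -> is_condexp P H (restrict_elt A xi) zeta ->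
  {ae P, forall w, A w -> X w (zeta w)}.
Proof.
move=> mX cX vX mxi Xxi HA cexp; have [_ mzeta _ _] := cexp.
have [c dc] := separable_dense_seq sepV.
pose N := A `&` [set w | ~ X w (zeta w)].
have HN : H N by apply: sa_setI => //; apply: (sa_not sH); exact: sa_mem_random_set.
pose r (k : nat) : R := k.+1%:R^-1.
have r0 k : 0 < r k by rewrite invr_gt0.
have /choice[D DP] : forall jk : nat * nat, exists D, [/\ H D,
    forall w, D w -> exists2 x, X w x & `|x - c jk.1| < r jk.2 + r jk.2 &
    P.-negligible ([set w | exists2 x, X w x & `|x - c jk.1| < r jk.2 + r jk.2] `\` D)].
  by move=> jk; exact: measurable_hitting.
pose C jk := N `&` [set w | `|zeta w - c jk.1| < r jk.2] `\` D jk.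
have HC jk : H (C jk).
  apply: sa_setD => //; last by have [] := DP jk.
  apply: sa_setI => //.
  exact: (sa_dist_lt sepV (r jk.2) sH mzeta (random_element_cst (c jk.1) sH)).
have negC jk : P.-negligible (C jk).
  apply/negligibleP; first exact/HF.
  apply/eqP; rewrite eq_le measure_ge0 andbT leNgt; apply/negP => PC.
  have [||||C' [HC' C'C PC' hit]] := @condexp_ball_hits X xi A zeta (C jk)
    (c jk.1) (r jk.2) (r jk.2) mX mxi Xxi HA cexp (HC jk) _ PC.
  - by move=> w [[[]]].
  - exact: ltW.
  - exact: r0.
  - by move=> w [[_ /ltW]].
  have : P.-negligible C'.
    have [_ _ negl] := DP jk; apply: negligibleS (negligibleU vX negl) => w C'w.
    have [cXw|nX] := pselect (convex_set (X w)); last by left.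
    by right; split; [exact: hit|have [] := C'C w C'w].
  by move/negligibleP => /(_ (HF HC')) PC'E; rewrite PC'E ltxx in PC'.
apply: negligibleS (negligibleU cX (negligible_bigcup
  (fun n => negC (odflt (0%N, 0%N) (unpickle n))))).
move=> w /= /not_implyP[Aw nXw].
have [cXw|nX] := pselect (closed (X w)); last by left.
right.
have [e e0 eX] : exists2 e : R, 0 < e & ball (zeta w) e `<=` ~` X w.
  have /nbhs_ballP[e /= e0 eX] : nbhs (zeta w) (~` X w).
    by apply: open_nbhs_nbhs; split => //; exact: closed_openC.
  by exists e.
have e3 : 0 < e / 3 by rewrite divr_gt0.
have [k] := ltr_add_invr e3; rewrite add0r => ke.
have [j jP] := dc (zeta w) _ (r0 k).
exists (pickle (j, k)) => //; rewrite pickleK /=; split; first by [].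
have [_ Dw _] := DP (j, k); move=> /Dw[x Xx /= xc]; apply: (eX x) => //.
rewrite -ball_normE /= -(subrKA (c j)) (le_lt_trans (ler_normD _ _))//.
rewrite (distrC (c j)); apply: lt_trans (ltrD jP xc) _.
rewrite -/(r k) in ke; move: (r k) ke => rk ke; lra.
Qed.

End random_sets_lemmas.

(** * The generalised conditional expectation of a random set *)

Section gcondexp.
Context {d : measure_display} {T : measurableType d} {R : realType}
  {V : completeNormedModType R}.
Variables (P : probability T R) (H : set (set T)).
Hypothesis (sH : sigma_algebra setT H) (HF : H `<=` measurable).
Hypothesis sepV : separable V.
Implicit Types (X Y : T -> set V) (xi eta zeta : T -> V).

Let sF : sigma_algebra setT (@measurable _ T) := sigma_algebra_measurable T.

(** The Aumann selection, made global: outside a null set [X w] is non-empty,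
    and the selection is defined. *)
Lemma L0_nonempty X : random_set H X -> ae_nonempty P X -> L0 P X H !=set0.
Proof.
move=> mX nX; have [D [xi [HD mxi Dxi negl]]] := measurable_selection P sH HF sepV mX.
exists xi; split=> //; apply: negligibleS (negligibleU nX negl) => w /= nXxi.
have [[x Xx]|nXw] := pselect (X w !=set0); last by left.
by right; split; [exists x|move=> /Dxi].
Qed.

(** A measurable selection of the difference of the two random sets, completed
    by any selection of [X], is a selection of [X] and hence of [Y]; so it is
    defined on a null set only. *)
Lemma L0_sub_subset X Y : random_set H X -> random_set H Y ->
  L0 P X H !=set0 -> L0 P X H `<=` L0 P Y H -> {ae P, forall w, X w `<=` Y w}.
Proof.
move=> mX mY [xi0 [mxi0 Xxi0]] XY.
have mG := measurableD mX mY.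
have [D [xi [HD mxi Dxi negl]]] := measurable_selection P sH HF sepV mG.
pose xi' w := (if w \in D then xi else xi0) w.
have mxi' : random_element H xi' by exact: random_element_if.
have [_ Yxi'] : L0 P Y H xi'.
  apply: XY; split=> //; apply: negligibleS Xxi0 => w /=; rewrite /xi'.
  by case: ifPn => // /set_mem /Dxi[].
apply: negligibleS (negligibleU Yxi' negl) => w /= nXY.
have [Dw|nDw] := pselect (D w).
  by left; rewrite /= /xi' mem_set//; have [] := Dxi w Dw.
right; split=> //; apply: contrapT => nG; apply: nXY => x Xx.
by apply: contrapT => nY; apply: nG; exists x.
Qed.

Lemma partition_label (A : nat -> set T) : countable_partition H A ->
  exists l : T -> nat, forall w i, A i w <-> l w = i.
Proof.
move=> [_ trivA coverA].
have /choice[l lP] : forall w, exists i, A i w.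
  by move=> w; have : setT w by []; rewrite -coverA => -[i _ ?]; exists i.
exists l => w i; split=> [Aw|<-//].
by apply: trivA => //; exists w; split.
Qed.

Lemma partition_sum (A : nat -> set T) (l : T -> nat) (zeta : nat -> T -> V) w :
  (forall w i, A i w <-> l w = i) ->
  \sum_(i < n) restrict_elt (A i) (zeta i) w @[n --> \oo] --> zeta (l w) w.
Proof.
move=> lP; apply: cvg_near_cst; exists (l w).+1 => // n /= ln.
rewrite (bigD1 (Ordinal ln))//= restrict_eltE ?big1 ?addr0//; last exact/lP.
move=> i /eqP il; rewrite restrict_eltN// => /lP lwi; apply: il; exact/val_inj.
Qed.

(** The sets where the norm of [xi] lies between two consecutive integers are
    in [H], and [xi] is bounded on each. *)
Lemma gcondexp_self xi : random_element H xi ->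
  admits_gcondexp P H xi /\ is_gcondexp P H xi xi.
Proof.
move=> mxi.
pose l w := first (fun n => `|xi w - 0| < n.+1%:R).
have lP w : `|xi w - 0| < (l w).+1%:R.
  have [] := @firstP (fun n => `|xi w - 0| < n.+1%:R) => //.
  exists (Num.truncn `|xi w - 0|); exact: truncnS_gt.
pose A n := [set w | l w = n].
have HA n : H (A n).
  apply: (sa_first sH) => i.
  exact: (sa_dist_lt sepV _ sH mxi (random_element_cst 0 sH)).
have pA : countable_partition H A.
  split => //; first by move=> i j _ _ [w [<- <-]].
  by apply/seteqP; split=> // w _; exists (l w).
have mxiF : random_element measurable xi by exact: random_elementS mxi.
have bA n : bochner_integrable P (restrict_elt (A n) xi).
  apply: (bochner_integrable_bounded P (M := n.+1%:R) sepV).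
    by apply: random_element_restrict => //; exact/HF.
  move=> w; have [Aw|nAw] := pselect (A n w).
    by rewrite restrict_eltE// -[xi w]subr0 -Aw ltW.
  by rewrite restrict_eltN// normr0.
split; first by exists A; split.
exists A, (fun n => restrict_elt (A n) xi); split=> //.
- move=> n; split=> //; first exact: random_element_restrict.
  move=> B HB; have [v vP] := bochner_integral_exists sepV
    (bochner_integrable_restrict sepV (HF HB) (bA n)).
  by exists v.
- move=> w.
  have := @partition_sum A l (fun n => restrict_elt (A n) xi) w (fun _ _ => iff_refl _).
  by rewrite restrict_eltE.
Qed.

(** On each cell of the partition the sum defining [eta] reduces to a single
    term, to which [condexp_mem] applies. *)
Lemma gcondexp_mem X xi eta : random_set H X -> ae_closed P X -> ae_convex P X ->
  L0 P X measurable xi -> is_gcondexp P H xi eta -> L0 P X H eta.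
Proof.
move=> mX cX vX [mxi Xxi] [A [zeta [pA bA cA sumA]]].
have [l lP] := partition_label pA.
have etaE w : eta w = zeta (l w) w.
  have hV := @norm_hausdorff R V.
  by rewrite -(cvg_lim hV (sumA w)) -(cvg_lim hV (@partition_sum A l zeta w lP)).
have HA i : H (A i) by case: pA.
split.
  rewrite (_ : eta = fun w => zeta (l w) w); last exact/funext.
  apply: random_element_glue => // i; last by have [] := cA i.
  by rewrite (_ : mkset _ = A i)//; apply/seteqP; split => w /= /lP.
have /negligible_bigcup : forall i, P.-negligible (~` [set w | A i w -> X w (zeta i w)]).
  by move=> i; exact: (condexp_mem sH HF sepV mX cX vX mxi Xxi (HA i) (cA i)).
apply: negligibleS => w /= nX; exists (l w) => //= h; apply: nX.
by rewrite etaE; apply: h; exact/lP.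
Qed.

(** If the ball of radius [1/(k+1)] around [eta w] misses [X w], then every [xi
    n w] in [X w] is at least that far from [eta w], and the probability of
    this tends to 0 with [n]. *)
Lemma cvg_in_probability_mem X (xi : nat -> T -> V) eta : ae_closed P X ->
  random_element H eta -> (forall n, L0 P X H (xi n)) ->
  cvg_in_probability P xi eta -> L0 P X H eta.
Proof.
move=> cX meta Xxi xieta; split=> //.
have mE (e : R) n : measurable [set w | e <= `|xi n w - eta w|].
  have [mxi _] := Xxi n.
  rewrite (_ : mkset _ = ~` [set w | `|xi n w - eta w| < e]).
    by apply/measurableC/HF; exact: sa_dist_lt.
  by apply/seteqP; split=> w /=; rewrite leNgt => /negP.
have negE k : P.-negligible (\bigcap_n [set w | k.+1%:R^-1 <= `|xi n w - eta w|]).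
  have mI := bigcapT_measurable (mE k.+1%:R^-1).
  apply/negligibleP => //; apply/eqP; rewrite eq_le measure_ge0 andbT.
  have k0 : (0 < k.+1%:R^-1 :> R) by rewrite invr_gt0.
  apply: (cvge_ge _ (xieta _ k0)); apply: nearW => n.
  by apply: le_measure; rewrite ?inE//; exact: bigcap_inf.
have negX := negligible_bigcup (fun n => (Xxi n).2).
apply: negligibleS (negligibleU (negligibleU cX negX) (negligible_bigcup negE)).
move=> w /= nX; have [cXw|] := pselect (closed (X w)); last by left; left.
have [Xn|/existsNP[n nXn]] := pselect (forall n, X w (xi n w)); last first.
  by left; right; exists n.
right.
have /nbhs_ballP[e /= e0 eX] : nbhs (eta w) (~` X w).
  by apply: open_nbhs_nbhs; split => //; exact: closed_openC.
have [k] := ltr_add_invr e0; rewrite add0r => ke.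
exists k => // n _ /=; rewrite leNgt; apply/negP => lt.
apply: (eX (xi n w)) (Xn n); rewrite -ball_normE /= distrC.
exact: lt_trans ke.
Qed.

Lemma L0_gcondexp X : random_set H X -> ae_closed P X -> ae_convex P X ->
  L0 P X H =
  cl0 P H [set eta | exists2 xi, L1H P H X xi & is_gcondexp P H xi eta].
Proof.
move=> mX cX vX; apply/seteqP; split => eta.
  move=> [meta Xeta]; split=> //; exists (fun=> eta); split; last first.
    move=> e e0; rewrite (_ : [set w | _] = set0) ?measure0; first exact: cvg_cst.
    by apply/seteqP; split=> // w /=; rewrite subrr normr0 leNgt e0.
  have [adm self] := gcondexp_self meta.
  move=> _; exists eta => //; split=> //; split=> //; exact: random_elementS meta.
move=> [meta [xi [xiP cvg_xi]]].
apply: (cvg_in_probability_mem cX meta _ cvg_xi) => n.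
have [zeta [Xzeta _] gzeta] := xiP n; exact: gcondexp_mem gzeta.
Qed.

End gcondexp.
Unset Implicit Arguments.

Theorem corollary6p6 (R : realType) (V : completeNormedModType R)
    (d : measure_display) (T : measurableType d) (P : probability T R)
    (H : set (set T)) (X : T -> set V) :
  separable V ->
  measure_is_complete P ->
  sub_sigma_algebra_of H measurable ->
  random_set H X ->
  ae_nonempty P X -> ae_closed P X -> ae_convex P X ->
  is_gcondexp_set P H X X /\
  (forall Y : T -> set V, is_gcondexp_set P H X Y ->
     {ae P, forall w, Y w = X w}).
Proof.
move=> sepV _ [sH HF] mX nX cX vX.
have L0X := L0_gcondexp sH HF sepV mX cX vX.
have [xi [mxi Xxi]] := L0_nonempty sH HF sepV mX nX.
have L0n : L0 P X H !=set0 by exists xi.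
split.
  split=> //; exists xi; have [adm _] := gcondexp_self P sH HF sepV mxi.
  split=> //; split=> //; apply: random_elementS mxi => //.
  exact: sigma_algebra_measurable.
move=> Y [_ mY cY L0Y].
have L0XY : L0 P X H = L0 P Y H by rewrite L0X L0Y.
have XY : {ae P, forall w, X w `<=` Y w}.
  by apply: (L0_sub_subset sH HF sepV) => //; rewrite L0XY.
have YX : {ae P, forall w, Y w `<=` X w}.
  by apply: (L0_sub_subset sH HF sepV) => //; rewrite -L0XY.
apply: negligibleS (negligibleU XY YX) => w /= nE.
have [XYw|nXY] := pselect (X w `<=` Y w); last by left.
by right => YXw; apply: nE; apply/seteqP.
Qed.
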